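(* Fix $\epsilon=(\epsilon_0,\epsilon_1,\epsilon_2)\in\mathbb R_+^3$, $\gamma,R_F,R_\lambda>0$, and a rank profile $\mathbf k=(k_1,\dots,k_q)$ of positive integers before sampling the block costs. Given $\bar C_c\in\mathbb S^{n_c}$ and radii $\sigma_c>0$, independently draw $$C_c\sim\operatorname{Unif}\{D\in\mathbb S^{n_c}:\|D-\bar C_c\|_F\le\sigma_c\},\qquad c\in[q].$$ Let $a_c:=\|\mathcal A_c\|_{F\to2}$ and $$\mathcal J:=\{c\in[q]:k_c\le n_c,\ a_c>0\},\qquad \delta_c:=\frac{\epsilon_1a_c}{\gamma},\qquad \kappa_c:=R_\lambda a_c .$$ Suppose that for every $c\in\mathcal J$, $$\tau(k_c)>r_c,\qquad 0<\delta_c\le\kappa_c,\qquad \delta_c<\frac{\sigma_c}{4n_c^3}.$$ Then, with probability at least $1-\sum_{c\in\mathcal J}p_c$, where $$p_c:=4\mathrm e\left(\frac{3\kappa_c}{\delta_c}\right)^{r_c}\left(\frac{4n_c^3\delta_c}{\sigma_c}\right)^{\tau(k_c)},$$ every product $(\epsilon,\gamma)$-AFAC pair $(F,\lambda)$ (for the sampled costs $C_c$, at profile $\mathbf k$) satisfying $\|F\|_\oplus\le R_F$ and $\|\lambda\|_2\le R_\lambda$ obeys, with $X_c:=F_cF_c^\top$, $$X_c\succeq0\ (c\in[q]),\qquad \Bigl\|\sum_c\mathcal A_c(X_c)-b\Bigr\|_2\le\epsilon_0,\qquad \Bigl(\sum_c\|S_c(\lambda)X_c\|_F^2\Bigr)^{1/2}\le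 R_F\epsilon_1,\qquad S_c(\lambda)\succeq-\epsilon_2I_{n_c}\ (c\in[q]).$$ Blocks $c$ with $k_c>n_c$ or $a_c=0$ satisfy the final inequality $S_c(\lambda)\succeq-\epsilon_2I_{n_c}$ deterministically and do not contribute a failure probability.
   Context: Let $q,m,n_1,\dots,n_q$ be positive integers, $[q]=\{1,\dots,q\}$, and $\mathbb S^n$ the real symmetric $n\times n$ matrices. Fix $b\in\mathbb R^m$ and linear maps $\mathcal A_c:\mathbb S^{n_c}\to\mathbb R^m$, $(\mathcal A_c(X))_i=\langle A_{c,i},X\rangle$ with $A_{c,i}\in\mathbb S^{n_c}$, adjoints $\mathcal A_c^*(y)=\sum_iy_iA_{c,i}$. The $m$ affine constraints $\sum_c\mathcal A_c(X_c)=b$ are given in a linearly independent representation, i.e. the map $(H_1,\dots,H_q)\mapsto\sum_c\mathcal A_c(H_c)$ has rank $m$. When $\mathcal A_c$ is applied to a nonsymmetric matrix $M$, it means $(\mathcal A_c(M))_i=\langle A_{c,i},M\rangle=\operatorname{tr}(A_{c,i}^\top M)$. Let $r_c:=\operatorname{rank}(\mathcal A_c)$, $\tau(k):=k(k+1)/2$, and let $\|\mathcal A_c\|_{F\to2}$ be the operator norm of $\mathcal A_c$ from the Frobenius norm to the Euclidean norm. $\mathrm e$ is Euler's number. Factors: $F=(F_1,\dots,F_q)$, $F_c\in\mathbb R^{n_c\times k_c}$, $\|F\|_\oplus^2:=\sum_c\|F_c\|_F^2$ (same for $U$). Set $c(F):=\sum_c\mathcal A_c(F_cF_c^\top)-b$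 and, for $\lambda\in\mathbb R^m$, $S_c(\lambda):=C_c-\mathcal A_c^*(\lambda)$. For $\epsilon=(\epsilon_0,\epsilon_1,\epsilon_2)$ and $\gamma>0$, a pair $(F,\lambda)$ is a product $(\epsilon,\gamma)$-AFAC (approximate feasible approximate criticality) pair if $\|c(F)\|_2\le\epsilon_0$, $\bigl(\sum_c\|S_c(\lambda)F_c\|_F^2\bigr)^{1/2}\le\epsilon_1$, and $\sum_c\langle U_c,S_c(\lambda)U_c\rangle\ge-\epsilon_2$ for every factor-shaped $U$ with $\|U\|_\oplus=1$ and $\bigl\|\sum_c\mathcal A_c(U_cF_c^\top)\bigr\|_2\le\gamma$. *)

(* Defs.v *)
From HB Require Import structures.
From mathcomp Require Import all_boot all_order all_algebra.
From mathcomp Require Import all_classical all_reals all_analysis.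

Set Implicit Arguments.
Unset Strict Implicit.
Unset Printing Implicit Defensive.

Import Order.TTheory GRing.Theory Num.Theory.

Local Open Scope classical_set_scope.
Local Open Scope ring_scope.

Definition tau (k : nat) : nat := (k * k.+1)./2.

Section linear_algebra.
Context {R : realType}.

(* On a column vector this is the Euclidean norm. *)
Definition frob (p r : nat) (M : 'M[R]_(p, r)) : R :=
  Num.sqrt (\sum_(i < p) \sum_(j < r) M i j ^+ 2).

Definition psd (p : nat) (M : 'M[R]_p) : Prop :=
  M^T = M /\ forall v : 'cV[R]_p, 0 <= \tr (v^T *m M *m v).

Definition loewner_ge (p : nat) (M N : 'M[R]_p) : Prop := psd (M - N).

Definition symv (p : nat) : {vspace 'M[R]_p} := fixedSpace (linfun (@trmx R p p)).

Definition Aop (m p : nat) (A : 'I_m -> 'M[R]_p) (X : 'M[R]_p) : 'cV[R]_m :=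
  \col_(i < m) \tr ((A i)^T *m X).

Lemma Aop_is_linear (m p : nat) (A : 'I_m -> 'M[R]_p) : linear (Aop A).
Proof.
move=> a X Y; apply/colP => i.
by rewrite !mxE mulmxDr -scalemxAr raddfD /= mxtraceZ.
Qed.

HB.instance Definition _ (m p : nat) (A : 'I_m -> 'M[R]_p) :=
  GRing.isLinear.Build R 'M[R]_p 'cV[R]_m _ (Aop A) (Aop_is_linear A).

Definition Aadj (m p : nat) (A : 'I_m -> 'M[R]_p) (y : 'cV[R]_m) : 'M[R]_p :=
  \sum_(i < m) y i 0 *: A i.

(* The domain of the operator is the space of symmetric matrices, so its range
   is the image of [symv p]. *)
Definition Arange (m p : nat) (A : 'I_m -> 'M[R]_p) : {vspace 'cV[R]_m} :=
  (linfun (Aop A) @: symv p)%VS.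

Definition Arank (m p : nat) (A : 'I_m -> 'M[R]_p) : nat := \dim (Arange A).

Definition Anorm (m p : nat) (A : 'I_m -> 'M[R]_p) : R :=
  sup [set frob (Aop A X) | X in [set X : 'M[R]_p | X^T = X /\ frob X <= 1]].

End linear_algebra.

Section product_problem.
Context {R : realType} {q m : nat} {n k : 'I_q -> nat}.
Implicit Types (A : forall c : 'I_q, 'I_m -> 'M[R]_(n c)) (b lambda : 'cV[R]_m)
  (C : forall c : 'I_q, 'M[R]_(n c)) (F U : forall c : 'I_q, 'M[R]_(n c, k c)).

(* Rank of (H_c)_c |-> \sum_c A_c(H_c): the range of this map is the sum of
   the ranges of the A_c. *)
Definition joint_rank A : nat := \dim (\sum_(c < q) Arange (A c))%VS.

Definition oplus_norm F : R := Num.sqrt (\sum_(c < q) frob (F c) ^+ 2).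

Definition gram F (c : 'I_q) : 'M[R]_(n c) := F c *m (F c)^T.

Definition residual A b (X : forall c : 'I_q, 'M[R]_(n c)) : 'cV[R]_m :=
  \sum_(c < q) Aop (A c) (X c) - b.

Definition slack A C lambda (c : 'I_q) : 'M[R]_(n c) :=
  C c - Aadj (A c) lambda.

Definition AFAC A b C (eps0 eps1 eps2 gamma : R) F lambda : Prop :=
  [/\ frob (residual A b (gram F)) <= eps0,
      Num.sqrt (\sum_(c < q) frob (slack A C lambda c *m F c) ^+ 2) <= eps1 &
      forall U, oplus_norm U = 1 ->
        frob (\sum_(c < q) Aop (A c) (U c *m (F c)^T)) <= gamma ->
        - eps2 <= \sum_(c < q) \tr ((U c)^T *m (slack A C lambda c *m U c))].

End product_problem.

(* The sigma-algebra on matrices generated by the entries; for entries in R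
   these are the Borel sets. *)
Definition measure_matrix_display : measure_display -> measure_display.
Proof. exact. Qed.

Section measurable_matrix.
Context {d : measure_display} {T : measurableType d} (p r : nat).

Let entry (i : 'I_(p * r)) (M : 'M[T]_(p, r)) : T := mxvec M ord0 i.

Let mx_set0 : g_sigma_preimage entry set0.
Proof. exact: sigma_algebra0. Qed.

Let mx_setC B : g_sigma_preimage entry B -> g_sigma_preimage entry (~` B).
Proof. exact: sigma_algebraC. Qed.

Let mx_bigcup (B : (set 'M[T]_(p, r))^nat) :
  (forall i, g_sigma_preimage entry (B i)) ->
  g_sigma_preimage entry (\bigcup_i B i).
Proof. exact: sigma_algebra_bigcup. Qed.

HB.instance Definition _ := @isMeasurable.Build (measure_matrix_display d)
  'M[T]_(p, r) (g_sigma_preimage entry) mx_set0 mx_setC mx_bigcup.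

End measurable_matrix.

Section uniform_law.
Context {R : realType}.

Fixpoint lebesgue_tuple (N : nat) : set (N.-tuple R) -> \bar R :=
  match N with
  | 0 => fun B => (\d_([tuple] : 0.-tuple R) B)%E
  | N'.+1 => pushforward (lebesgue_measure \x @lebesgue_tuple N')%E
               (fun xt : R * N'.-tuple R => [tuple of xt.1 :: xt.2])
  end.

(* The symmetric matrix whose lower triangle, read row by row, is t: row i of
   the triangle starts at position i (i + 1) / 2. *)
Definition sym_of_tuple (p : nat) (t : (tau p).-tuple R) : 'M[R]_p :=
  \matrix_(i < p, j < p) t`_(tau (maxn i j) + minn i j).

(* Lebesgue measure on symmetric matrices, carried by the linear isomorphism
   [sym_of_tuple]. The Lebesgue measure of the Frobenius inner product is a
   constant multiple of it; the constant cancels in [uniform_sym_ball]. *)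
Definition lebesgue_sym (p : nat) : set 'M[R]_p -> \bar R :=
  pushforward (@lebesgue_tuple (tau p)) (@sym_of_tuple p).

Definition sym_ball (p : nat) (Cbar : 'M[R]_p) (sigma : R) : set 'M[R]_p :=
  [set D | D^T = D /\ frob (D - Cbar) <= sigma].

Definition uniform_sym_ball (p : nat) (Cbar : 'M[R]_p) (sigma : R)
    (B : set 'M[R]_p) : \bar R :=
  (fine (lebesgue_sym (B `&` sym_ball Cbar sigma)) /
   fine (lebesgue_sym (sym_ball Cbar sigma)))%:E.

Definition mutually_independent (d : measure_display) (T : measurableType d)
    (P : probability T R) (I : finType) (d' : I -> measure_display)
    (T' : forall i : I, measurableType (d' i))
    (X : forall i : I, {RV P >-> T' i}) : Prop :=
  forall (K : {set I}) (B : forall i : I, set (T' i)),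
    (forall i, measurable (B i)) ->
    P (\bigcap_(i in [set` K]) (X i @^-1` B i)) =
    (\prod_(i in K) P (X i @^-1` B i))%E.

End uniform_law.

(* Main.v *)
Require Import Defs.
From HB Require Import structures.
From mathcomp Require Import all_boot all_order all_algebra.
From mathcomp Require Import all_classical all_reals all_analysis.
From mathcomp Require Import measurable_realfun ring lra zify.

Set Implicit Arguments.
Unset Strict Implicit.
Unset Printing Implicit Defensive.

Import Order.TTheory GRing.Theory Num.Theory.

Local Open Scope classical_set_scope.
Local Open Scope ring_scope.

(** Fix a block c and an AFAC pair (F, lambda). If some nonzero u satisfies a_c
    |F_c u| <= gamma |u|, then for every unit vector v the direction equal to v
    u^T / |u| in block c and zero elsewhere is admissible in the curvature
    condition, which then reads v^T S_c v >= - eps2; hence S_c >= - eps2 I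
    ([escape]). This settles the blocks with k_c > n_c or a_c = 0. Otherwise |u|
    < (a_c / gamma) |F_c u| for all nonzero u, and |S_c F_c|_F <= eps1 shows
    that S_c = C_c - A_c^*(lambda) contracts every nonzero vector of the
    k_c-dimensional range of F_c by a factor less than delta_c. It remains to
    see that this is unlikely, simultaneously for all lambda.

    The matrices A_c^*(lambda) with |lambda| <= R_lambda lie in a ball of radius
    kappa_c of a space of dimension at most r_c ([dim_adjoint_range]), and (3
    kappa_c / delta_c)^r_c balls of radius delta_c cover it ([covering]). So one
    fixes a centre Y and asks how likely it is that M = C_c - Y contracts a
    k-dimensional space by a factor less than t = 2 delta_c.

    Let the columns of V span that space and let f pick k rows of V with a minor
    of maximal modulus. Then W = V V_f^-1 is the identity in the rows f and, by
    Cramer's rule, has entries of modulus at most 1 ([maximal_minor]); so |M w|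
    < t sqrt n for each of its columns w. Suppose that M and M' are two
    symmetric matrices of this kind, for the same f, which agree outside the
    block f x f, with witnesses W and W'. The entries of W'^T (M - M') W are
    exactly the entries of M - M' in the block, and they are at most 2 t n in
    modulus ([near_singular_fibre]). Thus, once the other coordinates of M are
    fixed, the tau(k) coordinates in the block are confined to a box of side 2 t
    n.

    Shrinking towards the centre of the ball by rho = n / sqrt (n^2 + 1) leaves
    room for replacing each such box by a cube of side 2 sigma rho / (n k)
    inside the ball. The comparison of volumes ([lebesgue_tuple_fibre]) bounds
    the probability for one f by e (t n^2 k / sigma)^tau(k)
    ([near_singular_volume]). There are n^k maps f, and n^k k^tau(k) <= (2
    n)^tau(k) ([count_minors]), which gives p_c up to the factor 4. *)

(** * Lebesgue measure on tuples *)

Section lebesgue_tuple_measure.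
Context {R : realType}.
Notation lam := (@lebesgue_measure R).
Notation RL := (measurableTypeR R).

(** The sides are indexed by [nat], not ['I_N], so that the box of the tail of a
    tuple is obtained by shifting the index. *)
Definition box N (A : nat -> set R) : set (N.-tuple R) :=
  [set t | forall i : 'I_N, A i (tnth t i)].

Lemma measurable_box N (A : nat -> set R) :
  (forall i, measurable (A i)) -> measurable (@box N A).
Proof.
move=> mA.
have -> : @box N A =
    \bigcap_(i in [set: 'I_N]) ((fun t : N.-tuple R => tnth t i) @^-1` A i).
  by apply/seteqP; split=> t h i => [_|]; exact: h.
apply: fin_bigcap_measurable => // i _; rewrite -[X in measurable X]setTI.
exact: measurable_tnth.
Qed.

Lemma box_sigma_finite N (m : set (N.-tuple R) -> \bar R) :
  (forall A, (forall i, measurable (A i)) ->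
     m (box A) = (\prod_(i < N) lam (A i))%E) -> sigma_finite setT m.
Proof.
move=> mE; pose F (j : nat) := @box N (fun=> [set` `[- j%:R, j%:R]] : set R).
exists F; last first.
  move=> j; split; first by apply: measurable_box => i; exact: measurable_itv.
  rewrite mE; last by move=> i; exact: measurable_itv.
  rewrite -ge0_fin_numE; last by apply: prode_ge0 => i _; exact: measure_ge0.
  apply: prode_fin_num => i _.
  by rewrite lebesgue_measure_itv/=; case: ifPn => _; rewrite -?EFinD.
apply/seteqP; split=> // t _.
pose b := \sum_(i < N) `|tnth t i|.
have b0 : 0 <= b by apply: sumr_ge0.
exists (Num.bound b) => // i /=.
rewrite in_itv/= -ler_norml; apply/ltW/(le_lt_trans _ (archi_boundP b0)).
rewrite /b (bigD1 i)//= lerDl; exact: sumr_ge0.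
Qed.

(** [RL] and [R] carry the same measurable sets but different displays;
    [lebesgue_measure] lives on the first, tuples are built over the second. *)
Definition tcons N (xt : RL * N.-tuple R) : N.+1.-tuple R :=
  [tuple of (xt.1 : R) :: xt.2].

Lemma measurable_tcons N : measurable_fun setT (@tcons N).
Proof.
apply: (@measurable_cons _ _ (RL * N.-tuple R)%type R).
  exact: (@measurable_fst _ _ RL (N.-tuple R)%type).
exact: measurable_snd.
Qed.

Lemma box_cons N (A : nat -> set R) :
  @tcons N @^-1` box A =
  A 0%N `*` box (fun i => A i.+1).
Proof.
apply/seteqP; split=> -[x t] /=.
  move=> h; split=> [|i]; first exact: (h ord0).
  by have := h (lift ord0 i); rewrite /= tnthS.
move=> [/= h0 h] i; case: (unliftP ord0 i) => [j ->|->]; last exact: h0.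
by rewrite tnthS; exact: h.
Qed.

(** What the recursion defining [lebesgue_tuple] has to carry along: the box
    formula is part of it because it is what makes the measure sigma-finite, as
    the next product measure requires. *)
Definition box_measure N (m : set (N.-tuple R) -> \bar R) : Prop :=
  [/\ m set0 = 0%E, (forall A, (0 <= m A)%E), semi_sigma_additive m &
    forall A, (forall i, measurable (A i)) ->
      m (box A) = (\prod_(i < N) lam (A i))%E].

Lemma box_measureP N (m : set (N.-tuple R) -> \bar R) : box_measure m ->
  exists m' : {sigma_finite_measure set (N.-tuple R) -> \bar R}, m = m'.
Proof.
move=> [m0 mge0 madd mbox].
pose f1 := isMeasure.Build _ _ _ m m0 mge0 madd.
pose m1 : {measure set (N.-tuple R) -> \bar R} := HB.pack m f1.
pose f2 := @Measure_isSigmaFinite.Build _ _ _ m1 (box_sigma_finite mbox).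
by exists (HB.pack_for (sigma_finite_measure (N.-tuple R) R) (m1 :
  set _ -> \bar R) f1 f2).
Qed.

Lemma lebesgue_tuple_box_measure N : box_measure (@lebesgue_tuple R N).
Proof.
elim: N => [|N IH].
  split=> [|A||A mA]; [exact: measure0|exact: measure_ge0|exact:
    measure_semi_sigma_additive|].
  by rewrite big_ord0 /= /dirac indicE mem_set//=; case.
have [m mE] := box_measureP IH; have [_ _ _ mbox] := IH.
have mc := @measurable_tcons N.
rewrite mE in mbox; rewrite /box_measure /= mE.
split=> [|A||A mA].
- exact: (measure0 (pushforward (lam \x m)%E _)).
- exact: (measure_ge0 (pushforward (lam \x m)%E _)).
- exact: (measure_semi_sigma_additive (s:=(pushforward (lam \x m)%E _))).
- rewrite /pushforward box_cons product_measure1E//; last exact: measurable_box.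
  by rewrite mbox// big_ord_recl.
  exact: mA.
Qed.

Let lebesgue_tuple0 N : @lebesgue_tuple R N set0 = 0%E.
Proof. by case: (lebesgue_tuple_box_measure N). Qed.

Let lebesgue_tuple_ge0 N A : (0 <= @lebesgue_tuple R N A)%E.
Proof. by case: (lebesgue_tuple_box_measure N). Qed.

Let lebesgue_tuple_semi_sigma_additive N :
  semi_sigma_additive (@lebesgue_tuple R N).
Proof. by case: (lebesgue_tuple_box_measure N). Qed.

HB.instance Definition _ N := isMeasure.Build _ _ _ (@lebesgue_tuple R N)
  (lebesgue_tuple0 N) (@lebesgue_tuple_ge0 N)
  (@lebesgue_tuple_semi_sigma_additive N).

Lemma lebesgue_tuple_box N (A : nat -> set R) :
  (forall i, measurable (A i)) ->
  lebesgue_tuple (@box N A) = (\prod_(i < N) lam (A i))%E.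
Proof. by case: (lebesgue_tuple_box_measure N) => _ _ _; exact. Qed.

HB.instance Definition _ N := Measure_isSigmaFinite.Build _ _ _
  (@lebesgue_tuple R N) (box_sigma_finite (@lebesgue_tuple_box N)).

Lemma integral_lebesgue_tuple_cons N (f : N.+1.-tuple R -> \bar R) :
  measurable_fun setT f -> (forall t, 0 <= f t)%E ->
  (\int[@lebesgue_tuple R N.+1]_t f t =
   \int[lam]_x \int[@lebesgue_tuple R N]_t f (tcons (x, t)))%E.
Proof.
move=> mf f0.
have mfc := measurableT_comp mf (@measurable_tcons N).
pose mu : {measure set (RL * N.-tuple R)%type -> \bar R} :=
  (lam \x @lebesgue_tuple R N)%E.
have f0' : {in setT, forall y, (0 <= f y)%E} by move=> ? _; exact: f0.
rewrite [LHS](@ge0_integral_pushforward _ _ _ _ R _ (@measurable_tcons N)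
  mu _ _ measurableT mf f0') preimage_setT.
exact: (@fubini_tonelli1 _ _ RL (N.-tuple R)%type R lam (@lebesgue_tuple R N) _
  mfc (fun=> f0 _)).
Qed.

Lemma integral2_lebesgue_tuple_cons N (g :
  N.+1.-tuple R * N.+1.-tuple R -> \bar R) :
  measurable_fun setT g -> (forall t, 0 <= g t)%E ->
  (\int[@lebesgue_tuple R N.+1]_s \int[@lebesgue_tuple R N.+1]_t g (s, t) =
   \int[lam]_x \int[lam]_y \int[@lebesgue_tuple R N]_s \int[@lebesgue_tuple R
     N]_t
     g (tcons (x, s), tcons (y, t)))%E.
Proof.
move=> mg g0.
rewrite integral_lebesgue_tuple_cons; first last.
- by move=> t; exact: integral_ge0.
- exact: (@measurable_fun_fubini_tonelli_F _ _ _ _ _ (@lebesgue_tuple R N.+1) _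
  mg g0).
apply: eq_integral => x _.
transitivity (\int[@lebesgue_tuple R N]_s \int[lam]_y \int[@lebesgue_tuple R
  N]_t
     g (tcons (x, s), tcons (y, t)))%E.
  apply: eq_integral => s _; rewrite integral_lebesgue_tuple_cons //.
  by apply: measurableT_comp => //; exact: measurable_pair1.
apply: (@fubini_tonelli _ _ _ _ _ (@lebesgue_tuple R N) lam
  (fun sy => \int[@lebesgue_tuple R N]_t g (tcons (x, sy.1), tcons (sy.2,
    t)))%E).
  pose h (p : (N.-tuple R * RL) * N.-tuple R) := g (tcons (x, p.1.1),
    tcons (p.1.2, p.2)).
  apply: (@measurable_fun_fubini_tonelli_F _ _ _ _ _ (@lebesgue_tuple R N) h);
    last by move=> p; exact: g0.
  apply: (measurableT_comp mg); apply: measurable_fun_pair.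
    apply: (measurableT_comp (@measurable_tcons N));
      apply: measurable_fun_pair => //.
    by apply: measurableT_comp.
  apply: (measurableT_comp (@measurable_tcons N));
    apply: measurable_fun_pair => //.
  exact: (measurableT_comp measurable_snd).
by move=> p; apply: integral_ge0 => t _; exact: g0.
Qed.

Definition mix N (K : pred nat) (s t : N.-tuple R) : N.-tuple R :=
  [tuple if K i then tnth t i else tnth s i | i < N].

Definition exch N K (p : N.-tuple R * N.-tuple R) := (mix K p.1 p.2,
  mix K p.2 p.1).

Lemma mix_tcons N K (x y : R) (s t : N.-tuple R) :
  mix K (tcons (x, s)) (tcons (y, t)) =
  tcons (if K 0%N then y else x, mix (K \o S) s t).
Proof.
apply: eq_from_tnth => i; rewrite tnth_mktuple.
by case: (unliftP ord0 i) => [j ->|->] //=; rewrite !tnthS tnth_mktuple.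
Qed.

Lemma measurable_mix N K :
  measurable_fun setT (fun p : N.-tuple R * N.-tuple R => mix K p.1 p.2).
Proof.
apply/measurable_fun_tnthP => i.
rewrite (_ : _ \o _ = if K i then (@tnth N R ^~ i) \o snd
                      else (@tnth N R ^~ i) \o fst); last first.
  by apply/funext => p /=; rewrite tnth_mktuple; case: ifP.
by case: ifP => _; apply: measurableT_comp => //; exact: measurable_tnth.
Qed.

Lemma measurable_exch N K : measurable_fun setT (@exch N K).
Proof.
apply: measurable_fun_pair; first exact: measurable_mix.
exact: (measurableT_comp (@measurable_mix N K) (@measurable_swap _ _ _ _)).
Qed.

End lebesgue_tuple_measure.

Section exchange.
Context {R : realType}.
Notation lam := (@lebesgue_measure R).
Notation RL := (measurableTypeR R).

(** The product of two copies of Lebesgue measure does not change when the two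
    points exchange their coordinates in [K]. This replaces a decomposition of
    the space along an arbitrary set of coordinates: tuples need not be split or
    permuted, and the induction on the dimension is one use of Tonelli's theorem
    per coordinate. *)
Lemma integral_exch N K (g : N.-tuple R * N.-tuple R -> \bar R) :
  measurable_fun setT g -> (forall t, 0 <= g t)%E ->
  (\int[@lebesgue_tuple R N]_s \int[@lebesgue_tuple R N]_t g (exch K (s, t)) =
   \int[@lebesgue_tuple R N]_s \int[@lebesgue_tuple R N]_t g (s, t))%E.
Proof.
elim: N K g => [|N IH] K g mg g0.
  apply: eq_integral => s _; apply: eq_integral => t _.
  by congr g; rewrite /exch (tuple0 (mix _ _ _)) (tuple0 (mix _ _ _)) [s]tuple0
    [t]tuple0.
rewrite (integral2_lebesgue_tuple_cons
  (measurableT_comp mg (@measurable_exch _ N.+1 K)) (fun=> g0 _)).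
rewrite [RHS](integral2_lebesgue_tuple_cons mg g0).
have mg' x y : measurable_fun setT (fun p : N.-tuple R * N.-tuple R =>
    g (tcons (x, p.1), tcons (y, p.2))).
  apply: (measurableT_comp mg); apply: measurable_fun_pair.
    by apply: (measurableT_comp (@measurable_tcons _ N));
      apply: measurable_fun_pair.
  by apply: (measurableT_comp (@measurable_tcons _ N));
    apply: measurable_fun_pair.
transitivity (\int[lam]_x \int[lam]_y \int[@lebesgue_tuple R N]_s
  \int[@lebesgue_tuple R N]_t
     g (tcons (if K 0%N then y else x, s), tcons (if K 0%N then x else y,
       t)))%E.
  apply: eq_integral => x _; apply: eq_integral => y _.
  rewrite -[RHS](IH (K \o S) _ (mg' (if K 0%N then y else x)
    (if K 0%N then x else y)) (fun=> g0 _)).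
  apply: eq_integral => s _; apply: eq_integral => t _.
  by rewrite /exch /= !mix_tcons.
case: (K 0%N); last by [].
apply/esym/(@fubini_tonelli _ _ RL RL R lam lam
  (fun p => \int[@lebesgue_tuple R N]_s \int[@lebesgue_tuple R N]_t
     g (tcons (p.1, s), tcons (p.2, t)))%E).
  pose h (p : (RL * RL) * N.-tuple R) := (\int[@lebesgue_tuple R N]_t
     g (tcons (p.1.1, p.2), tcons (p.1.2, t)))%E.
  apply: (@measurable_fun_fubini_tonelli_F _ _ _ _ _ (@lebesgue_tuple R N) h);
    last first.
    by move=> p; apply: integral_ge0 => t _; exact: g0.
    pose h' (p : ((RL * RL) * N.-tuple R) * N.-tuple R) :=
     g (tcons (p.1.1.1, p.1.2), tcons (p.1.1.2, p.2)).
    apply: (@measurable_fun_fubini_tonelli_F _ _ _ _ _ (@lebesgue_tuple R N)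
      h');
      last by move=> p; exact: g0.
    apply: (measurableT_comp mg); apply: measurable_fun_pair.
      apply: (measurableT_comp (@measurable_tcons _ N));
        apply: measurable_fun_pair => //.
        by do 2 apply: measurableT_comp => //.
      exact: (measurableT_comp measurable_snd).
    apply: (measurableT_comp (@measurable_tcons _ N));
      apply: measurable_fun_pair => //.
    by apply: (measurableT_comp measurable_snd) => //; apply: measurableT_comp.
by move=> p; apply: integral_ge0 => s _; apply: integral_ge0 => t _; exact: g0.
Qed.

End exchange.

Section scaling.
Context {R : realType}.
Notation lam := (@lebesgue_measure R).
Notation RL := (measurableTypeR R).

Lemma measurable_affine (rho v : R) :
  measurable_fun setT ((fun x => rho * x + v) : RL -> RL).
Proof.
apply: measurable_funD => //; apply: measurable_funM => //.
Qed.

(** Uniqueness of Lebesgue measure: the image of [rho * lam] under the map has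
    the right value on intervals. *)
Lemma lebesgue_measure_affine (rho v : R) (A : set RL) : 0 < rho ->
  measurable A ->
  lam ((fun x => rho * x + v) @^-1` A) = (rho^-1%:E * lam A)%E.
Proof.
move=> rho0 mA; have mf := measurable_affine rho v.
have rho'0 : 0 <= rho by exact: ltW.
have : lam A = pushforward (mscale (NngNum rho'0) lam)
    ((fun x => rho * x + v) : RL -> RL) A.
  apply: lebesgue_measure_unique => // _ [[a b]] _ <-.
  have E : (fun x => rho * x + v) @^-1` [set` `]a, b]] =
    [set` `]((a - v) / rho), ((b - v) / rho)]].
    apply/seteqP; split=> x /=; rewrite !in_itv/= ltr_pdivrMr// ler_pdivlMr//
      ltrBlDr lerBrDr [x * rho]mulrC//.
  transitivity (rho%:E * lam [set` `]((a - v) / rho)%R, ((b - v) / rho)%R]])%E;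
    last by rewrite -E.
  rewrite !lebesgue_measure_itv/= !lte_fin ltr_pM2r ?invr_gt0// ltrD2r.
  case: ifP => _; last by rewrite mule0.
  rewrite -EFinB -EFinB -EFinM; congr EFin.
  by rewrite -mulrBl mulrC divfK ?gt_eqF// opprB addrA subrK.
rewrite /pushforward /mscale/= => ->.
by rewrite muleA -EFinM mulVf ?mul1e// gt_eqF.
Qed.

Lemma lebesgue_tuple_cons N (A : set (N.+1.-tuple R)) :
  lebesgue_tuple A =
  (\int[lam]_x @lebesgue_tuple R N [set t | A (tcons (x, t))])%E.
Proof.
apply: eq_integral => x _; congr (lebesgue_tuple _).
by apply/seteqP; split=> t; rewrite /xsection /= ?inE// => ?; rewrite inE.
Qed.

Lemma measurable_tcons_section N (A : set (N.+1.-tuple R)) (x : R) :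
  measurable A -> measurable [set t | A (tcons (x, t))].
Proof.
move=> mA; rewrite -[X in measurable X]setTI.
apply: (measurableT_comp (@measurable_tcons R N) (g := fun t =>
  (x : RL, t))) => //.
exact: measurable_fun_pair.
Qed.

Lemma measurable_lebesgue_section N (A : set (N.+1.-tuple R)) : measurable A ->
  measurable_fun [set: RL]
    (fun x : RL => @lebesgue_tuple R N [set t | A (tcons (x, t))]).
Proof.
move=> mA.
have mtA : measurable (@tcons R N @^-1` A).
  by rewrite -[X in measurable X]setTI; exact: measurable_tcons.
apply: (eq_measurable_fun _ _ (measurable_fun_xsection (@lebesgue_tuple R N)
  mtA)).
move=> x _ /=; congr (lebesgue_tuple _).
by apply/seteqP; split=> t; rewrite /xsection /= ?inE// => ?; rewrite inE.
Qed.

Definition affine N (rho : R) (v : nat -> R) (t : N.-tuple R) : N.-tuple R :=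
  [tuple rho * tnth t i + v i | i < N].

Lemma measurable_affine_tuple N (rho : R) (v : nat -> R) :
  measurable_fun setT (@affine N rho v).
Proof.
apply/measurable_fun_tnthP => i.
rewrite (_ : _ \o _ = fun t : N.-tuple R => rho * tnth t i + v i); last first.
  by apply/funext => t /=; rewrite tnth_mktuple.
by apply: measurable_funD => //; apply: measurable_funM => //;
  exact: measurable_tnth.
Qed.

Lemma lebesgue_tuple_affine N (rho : R) (v : nat -> R) (A : set (N.-tuple R)) :
  0 < rho -> measurable A ->
  lebesgue_tuple (@affine N rho v @^-1` A) =
  ((rho ^- N)%:E * lebesgue_tuple A)%E.
Proof.
move=> rho0; elim: N v A => [|N IH] v A mA.
  rewrite expr0 invr1 mul1e; congr (lebesgue_tuple _).
  by apply/seteqP; split=> t; rewrite [t]tuple0 /=;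
    rewrite [affine _ _ _]tuple0.
pose phi (y : RL) := @lebesgue_tuple R N [set t | A (tcons (y, t))].
rewrite 2!lebesgue_tuple_cons.
transitivity (\int[lam]_x ((rho ^- N)%:E * phi (rho * x + v 0%N)%R))%E.
  apply: eq_integral => x _; rewrite -(IH (v \o S)); last first.
    exact: measurable_tcons_section.
  congr (lebesgue_tuple _); apply/seteqP; split=> t /=; congr A;
    apply: eq_from_tnth => i; rewrite tnth_mktuple;
    by case: (unliftP ord0 i) => [j ->|->] //=; rewrite !tnthS tnth_mktuple.
have mphi : measurable_fun setT phi by exact: measurable_lebesgue_section.
have maff := measurable_affine rho (v 0%N).
rewrite ge0_integralZl//; last 2 first.
- exact: (measurableT_comp mphi).
- by rewrite lee_fin invr_ge0 exprn_ge0// ltW.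
rewrite exprS invfM mulrC EFinM -muleA; congr (_ * _)%E.
have phi0 : {in setT, forall y, (0 <= phi y)%E} by [].
rewrite -[LHS](@ge0_integral_pushforward _ _ _ _ R _ maff lam _ _ measurableT
  mphi phi0).
have rho'0 : 0 <= rho^-1 by rewrite invr_ge0 ltW.
rewrite -(@ge0_integral_mscale _ _ _ lam _ measurableT (NngNum rho'0)) //.
apply: eq_measure_integral => B mB _.
exact: (lebesgue_measure_affine _ rho0 mB).
Qed.
End scaling.

(** * Sets with thin fibres *)

Section fibre.
Context {R : realType}.
Notation lam := (@lebesgue_measure R).

(** The two side lengths let one lemma measure both boxes in the proof of
    [lebesgue_tuple_fibre]. *)
Lemma lebesgue_tuple_itvs N (K : pred nat) (a : nat -> R) (L h : R) :
  0 <= L -> 0 <= h ->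
  lebesgue_tuple (@box R N
    (fun i => [set` `[a i, a i + (if K i then L else h)]])) =
  (L ^+ #|[pred i : 'I_N | K i]| * h ^+ #|[pred i : 'I_N | ~~ K i]|)%:E.
Proof.
move=> L0 h0; rewrite lebesgue_tuple_box; last by move=> i;
  exact: measurable_itv.
rewrite -prodr_const -prodr_const (bigID (fun i : 'I_N => K i))/= EFinM.
congr (_ * _)%E; rewrite [RHS](big_morph EFin EFinM erefl);
  apply: eq_big => // i; rewrite ?inE// => Ki;
    rewrite lebesgue_measure_itv/= lte_fin.
  rewrite Ki ltrDl; case: ltP => [_|L0'];
    first by rewrite -EFinB addrAC subrr add0r.
  by congr EFin; apply/eqP; rewrite eq_le L0.
rewrite (negbTE Ki) ltrDl; case: ltP => [_|L0'];
  first by rewrite -EFinB addrAC subrr add0r.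
by congr EFin; apply/eqP; rewrite eq_le h0.
Qed.

Lemma lebesgue_tuple_cube N (a : nat -> R) (L : R) : 0 <= L ->
  lebesgue_tuple (@box R N (fun i => [set` `[a i, a i + L]])) = (L ^+ N)%:E.
Proof.
move=> L0; have /= -> := @lebesgue_tuple_itvs N xpredT a L L L0 L0.
by rewrite [X in _ * _ ^+ X]eq_card0 ?expr0 ?mulr1 ?[X in _ ^+ X]eq_cardT
  ?size_enum_ord.
Qed.

(** If the fibres of [B] in the directions [K] have diameter at most [L] in each
    coordinate, replacing each nonempty fibre by a cube of side [h] multiplies
    the volume by at least [(h / L) ^+ #|K|]. Proof: take the product of [B] and
    a cube [Q] of side [h] in all directions, and exchange the coordinates in
    [K]. The first component of the result lies in [B'], and, when it is fixed,
    the second one lies in a box with sides [L] in [K] and [h] elsewhere. The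
    projection of [B] along [K], which could fail to be measurable, never
    enters. *)
Lemma lebesgue_tuple_fibre N (K : pred nat) (B B' : set (N.-tuple R))
    (L h : R) (c : nat -> R) :
  measurable B -> measurable B' -> 0 <= L -> 0 < h ->
  (forall s t, B s -> B t ->
    (forall i : 'I_N, ~~ K i -> tnth s i = tnth t i) ->
    forall i : 'I_N, K i -> `|tnth s i - tnth t i| <= L) ->
  (forall s t, B t -> (forall i : 'I_N, ~~ K i -> tnth s i = tnth t i) ->
    (forall i : 'I_N, K i -> c i <= tnth s i <= c i + h) -> B' s) ->
  (lebesgue_tuple B * (h ^+ #|[pred i : 'I_N | K i]|)%:E <=
   lebesgue_tuple B' * (L ^+ #|[pred i : 'I_N | K i]|)%:E)%E.
Proof.
move=> mB mB' L0 h0 Bdiam BB'.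
set k := #|[pred i : 'I_N | K i]|; set k' := #|[pred i : 'I_N | ~~ K i]|.
(* The vacuous case distinction makes the volume of [Q] come out as the product
   of the powers for [K] and for its complement. *)
pose Q := @box R N (fun i => [set` `[c i, c i + (if K i then h else h)]]).
have mQ : measurable Q by apply: measurable_box => i; exact: measurable_itv.
have Qvol : lebesgue_tuple Q = (h ^+ k * h ^+ k')%:E.
  by rewrite lebesgue_tuple_itvs// ltW.
have hk'0 : 0 < h ^+ k' by rewrite exprn_gt0.
rewrite -(@lee_pmul2r _ (h ^+ k')%:E)//.
rewrite -!muleA -!EFinM -Qvol.
have mBQ : measurable (B `*` Q) by exact: measurableX.
pose g (p : N.-tuple R * N.-tuple R) : \bar R := (\1_(B `*` Q) p)%:E.
have mg : measurable_fun setT g.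
  by apply: measurableT_comp => //; exact: measurable_indic.
have g0 p : (0 <= g p)%E by rewrite lee_fin.
rewrite -(@product_measure1E _ _ _ _ _ (@lebesgue_tuple R N) (@lebesgue_tuple R
  N))//.
rewrite -[X in ((_ \x _) X)%E]setIT -integral_indic//.
rewrite (@fubini_tonelli1 _ _ _ _ _ (@lebesgue_tuple R N) (@lebesgue_tuple R N)
  g mg g0).
rewrite -(integral_exch K mg g0).
rewrite -[X in (lebesgue_tuple X * _)%E]setIT -integral_indic//.
rewrite -ge0_integralZr//; last 2 first.
- exact: measurableT_comp.
- by rewrite lee_fin mulr_ge0// exprn_ge0// ltW.
apply: ge0_le_integral => //.
- by move=> s _; apply: integral_ge0.
- exact: (@measurable_fun_fubini_tonelli_F _ _ _ _ _ (@lebesgue_tuple R N)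
    (g \o exch K) (measurableT_comp mg (@measurable_exch R N K)) (fun=> g0 _)).
- by apply: emeasurable_funM => //; exact/measurable_EFinP.
move=> s _.
pose G := [set t | (B `*` Q) (exch K (s, t))].
have mG : measurable G.
  rewrite -[X in measurable X]setTI.
  apply: (measurableT_comp (@measurable_exch R N K) (g := fun t => (s, t))) =>
    //.
  exact: measurable_pair1.
rewrite (_ : (\int[_]_t _)%E = lebesgue_tuple G); last first.
  by rewrite -[X in lebesgue_tuple X]setIT -integral_indic.
have [->|/set0P[t0 Gt0]] := eqVneq G set0;
  first by rewrite measure0 -EFinM lee_fin !mulr_ge0// exprn_ge0// ltW.
have sB' : B' s.
  case: Gt0 => /= Bm Qm; apply: (BB' _ _ Bm) => i Ki.
    by rewrite tnth_mktuple (negbTE Ki).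
  by have := Qm i; rewrite /= tnth_mktuple Ki/= in_itv.
rewrite indicE mem_set// mul1e.
(* A box centred at a point of the fibre would need sides [2 * L]; starting at
   the infimum, [L] is enough. *)
pose a i := if K i then inf [set nth 0 t i | t in G] else c i.
rewrite -(@lebesgue_tuple_itvs N K a)//; last exact: ltW.
apply: le_measure; rewrite ?inE//.
  by apply: measurable_box => i; exact: measurable_itv.
move=> t Gt i /=; rewrite /a; case: ifPn => Ki; last first.
  by case: Gt => _ /(_ i); rewrite /= tnth_mktuple (negbTE Ki).
have lb u : G u -> tnth t i - L <= tnth u i.
  move=> Gu; case: Gt => Bt _; case: Gu => Bu _.
  have := Bdiam _ _ Bt Bu _ i Ki; rewrite !tnth_mktuple Ki ler_norml => h'.
  suff : - L <= tnth t i - tnth u i <= L by lra.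
  by apply: h' => j Kj; rewrite !tnth_mktuple (negbTE Kj).
rewrite in_itv/=; apply/andP; split.
  apply: ge_inf; last by exists t; rewrite // (tnth_nth 0).
  by exists (tnth t i - L) => _ [u Gu <-]; rewrite -(tnth_nth 0); exact: lb.
rewrite -lerBlDr; apply: lb_le_inf.
  by exists (nth 0 t i), t.
by move=> _ [u Gu <-]; rewrite -(tnth_nth 0); exact: lb.
Qed.
End fibre.

(** * The Frobenius norm *)

Section frobenius.
Context {R : realType}.

Lemma cauchy_schwarz_sum (I : finType) (a b : I -> R) :
  (\sum_i a i * b i) ^+ 2 <= (\sum_i a i ^+ 2) * (\sum_i b i ^+ 2).
Proof.
set S := \sum_i a i * b i; set A := \sum_i a i ^+ 2; set B := \sum_i b i ^+ 2.
have B0 : 0 <= B by apply: sumr_ge0 => i _; rewrite sqr_ge0.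
have [B1|/eqP B1] := eqVneq B 0.
  suff -> : S = 0 by rewrite B1 mulr0 expr0n.
  apply: big1 => i _; have /eqP := B1.
  rewrite psumr_eq0 => [/allP/(_ i)|j _]; last by rewrite sqr_ge0.
  by rewrite mem_index_enum sqrf_eq0 => /(_ isT)/eqP ->; rewrite mulr0.
have {B1} {}B0 : 0 < B by rewrite lt_neqAle B0 andbT eq_sym; apply/eqP.
rewrite -subr_ge0 -(pmulr_rge0 _ B0).
have -> : B * (A * B - S ^+ 2) = \sum_i (B * a i - S * b i) ^+ 2.
  transitivity (\sum_i (B ^+ 2 * a i ^+ 2 - 2 * B * S * (a i * b i)
    + S ^+ 2 * b i ^+ 2)); last by apply: eq_bigr => i _; ring.
  by rewrite !big_split/= sumrN -!mulr_sumr -/A -/B -/S; ring.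
by apply: sumr_ge0 => i _; rewrite sqr_ge0.
Qed.

(** The inner product of the Frobenius norm. *)
Definition ip (p r : nat) (M N : 'M[R]_(p, r)) : R := \tr (M^T *m N).

Lemma ipE p r (M N : 'M[R]_(p, r)) : ip M N = \sum_i \sum_j M i j * N i j.
Proof.
rewrite exchange_big /=; apply: eq_bigr => j _; rewrite mxE.
by apply: eq_bigr => i _; rewrite mxE.
Qed.

Lemma ipC p r (M N : 'M[R]_(p, r)) : ip M N = ip N M.
Proof. by rewrite /ip -mxtrace_tr trmx_mul trmxK. Qed.

Lemma ipDr p r (M N N' : 'M[R]_(p, r)) : ip M (N + N') = ip M N + ip M N'.
Proof. by rewrite /ip mulmxDr mxtraceD. Qed.

Lemma ipZr p r a (M N : 'M[R]_(p, r)) : ip M (a *: N) = a * ip M N.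
Proof. by rewrite /ip -scalemxAr mxtraceZ. Qed.

Lemma ipBr p r (M N N' : 'M[R]_(p, r)) : ip M (N - N') = ip M N - ip M N'.
Proof. by rewrite -[- N']scaleN1r ipDr ipZr mulN1r. Qed.

Lemma ipDl p r (M N N' : 'M[R]_(p, r)) : ip (N + N') M = ip N M + ip N' M.
Proof. by rewrite ipC ipDr !(ipC M). Qed.

Lemma ipZl p r a (M N : 'M[R]_(p, r)) : ip (a *: N) M = a * ip N M.
Proof. by rewrite ipC ipZr ipC. Qed.

Lemma frob_ge0 p r (M : 'M[R]_(p, r)) : 0 <= frob M.
Proof. exact: sqrtr_ge0. Qed.

Lemma frob_sqE p r (M : 'M[R]_(p, r)) :
  frob M ^+ 2 = \sum_i \sum_j M i j ^+ 2.
Proof.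
rewrite sqr_sqrtr//; apply: sumr_ge0 => i _; apply: sumr_ge0 => j _.
by rewrite sqr_ge0.
Qed.

Lemma ip_frob p r (M : 'M[R]_(p, r)) : ip M M = frob M ^+ 2.
Proof. by rewrite frob_sqE ipE. Qed.

Lemma ip_le_frob p r (M N : 'M[R]_(p, r)) : `|ip M N| <= frob M * frob N.
Proof.
rewrite -(@ler_pXn2r _ 2)// ?nnegrE ?mulr_ge0 ?frob_ge0//.
rewrite real_normK ?num_real// exprMn !frob_sqE ipE !pair_bigA/=.
exact: cauchy_schwarz_sum.
Qed.

Lemma frobZ p r a (M : 'M[R]_(p, r)) : frob (a *: M) = `|a| * frob M.
Proof.
apply/eqP; rewrite -(@eqrXn2 _ 2) ?mulr_ge0 ?frob_ge0//; apply/eqP.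
by rewrite exprMn real_normK ?num_real// -!ip_frob ipZl ipZr mulrA.
Qed.

Lemma frobN p r (M : 'M[R]_(p, r)) : frob (- M) = frob M.
Proof. by rewrite -scaleN1r frobZ normrN1 mul1r. Qed.

Lemma frob_tr p r (M : 'M[R]_(p, r)) : frob M^T = frob M.
Proof. by rewrite /frob exchange_big/=;
  under eq_bigr do under eq_bigr do rewrite mxE. Qed.

Lemma ler_frobD p r (M N : 'M[R]_(p, r)) : frob (M + N) <= frob M + frob N.
Proof.
rewrite -(@ler_pXn2r _ 2)// ?nnegrE ?addr_ge0 ?frob_ge0//.
rewrite -ip_frob ipDl !ipDr (ipC N M) !ip_frob.
have := le_trans (ler_norm _) (ip_le_frob M N); nra.
Qed.

Lemma frob_distC p r (M N : 'M[R]_(p, r)) : frob (M - N) = frob (N - M).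
Proof. by rewrite -frobN opprB. Qed.

Lemma frob0 p r : frob (0 : 'M[R]_(p, r)) = 0.
Proof. by rewrite -(scale0r 0) frobZ normr0 mul0r. Qed.

Lemma frob_eq0 p r (M : 'M[R]_(p, r)) : (frob M == 0) = (M == 0).
Proof.
apply/eqP/eqP => [M0|->]; last exact: frob0.
apply/matrixP => i j; rewrite mxE.
have : frob M ^+ 2 == 0 by rewrite M0 expr0n.
rewrite frob_sqE pair_bigA psumr_eq0 => [/allP/(_ (i, j))|x _];
  last exact: sqr_ge0.
by rewrite mem_index_enum => /(_ isT); rewrite sqrf_eq0 => /eqP.
Qed.

Lemma frob_gt0 p r (M : 'M[R]_(p, r)) : (0 < frob M) = (M != 0).
Proof. by rewrite lt_neqAle frob_ge0 andbT eq_sym frob_eq0. Qed.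

Lemma entry_le_frob p r (M : 'M[R]_(p, r)) i j : `|M i j| <= frob M.
Proof.
rewrite -(@ler_pXn2r _ 2)// ?nnegrE ?frob_ge0// real_normK ?num_real//.
rewrite frob_sqE pair_bigA/= (bigD1 (i, j))//= lerDl.
by apply: sumr_ge0 => x _; rewrite sqr_ge0.
Qed.

Lemma frob_mulmx p r s (M : 'M[R]_(p, r)) (N : 'M[R]_(r, s)) :
  frob (M *m N) <= frob M * frob N.
Proof.
rewrite -(@ler_pXn2r _ 2)// ?nnegrE ?mulr_ge0 ?frob_ge0// exprMn !frob_sqE.
rewrite mulr_suml; apply: ler_sum => i _.
rewrite [in leRHS]exchange_big mulr_sumr; apply: ler_sum => j _.
by rewrite mxE cauchy_schwarz_sum.
Qed.

End frobenius.

(** * Covering a ball of a matrix subspace *)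

Section measurable_frob.
Context {R : realType} d (T : measurableType d).

Lemma measurable_frob p s (F : T -> 'M[R]_(p, s)) :
  (forall i j, measurable_fun setT (fun t => F t i j)) ->
  measurable_fun setT (fun t => frob (F t)).
Proof.
move=> mF.
have mS : measurable_fun setT (fun t => \sum_i \sum_j F t i j ^+ 2).
  apply: measurable_sum => i; apply: measurable_sum => j.
  exact: measurable_funX.
exact: (measurableT_comp (continuous_measurable_fun (@sqrt_continuous R)) mS).
Qed.

Lemma measurable_frob_le p s (F : T -> 'M[R]_(p, s)) (e : R) :
  (forall i j, measurable_fun setT (fun t => F t i j)) ->
  measurable [set t | frob (F t) <= e].
Proof.
move=> mF; rewrite -[X in measurable X]setTI.
rewrite (_ : [set t | _] = (fun t => frob (F t)) @^-1` [set` `]-oo, e]]).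
  by apply: (measurable_frob mF) => //; exact: measurable_itv.
by apply/seteqP; split=> t /=; rewrite in_itv.
Qed.

End measurable_frob.

Section covering.
Context {R : realType} {p s : nat} (U : {vspace 'M[R]_(p, s)}).
Let r := \dim U.
Let b := vbasis U.

Let comb (y : r.-tuple R) : 'M[R]_(p, s) := \sum_(i < r) tnth y i *: tnth b i.

Let coords (Z : 'M[R]_(p, s)) : r.-tuple R := [tuple coord b i Z | i < r].

Let coordsK Z : Z \in U -> comb (coords Z) = Z.
Proof.
move=> ZU; rewrite [RHS](coord_vbasis ZU).
by apply: eq_bigr => i _; rewrite tnth_mktuple (tnth_nth 0).
Qed.

Let comb_affine rho (v : nat -> R) (y : r.-tuple R) :
  comb (affine rho v y) = rho *: comb y + comb [tuple v i | i < r].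
Proof.
rewrite /comb scaler_sumr -big_split/=; apply: eq_bigr => i _.
by rewrite !tnth_mktuple scalerDl scalerA.
Qed.

Let measurable_comb i j : measurable_fun setT (fun y => comb y i j).
Proof.
rewrite (_ : (fun y => _) = fun y => \sum_(l < r) tnth y l * tnth b l i j).
  by apply: measurable_sum => l; apply: measurable_funM => //;
    exact: measurable_tnth.
by apply/funext => y; rewrite /comb summxE; apply: eq_bigr => l _; rewrite mxE.
Qed.

Let ball (e : R) := [set y | frob (comb y) <= e].

Let measurable_ball e : measurable (ball e).
Proof. by apply: measurable_frob_le => i j; exact: measurable_comb. Qed.

Let comb0 : comb [tuple 0 | i < r] = 0.
Proof. by rewrite /comb big1// => i _; rewrite tnth_mktuple scale0r. Qed.

Let ball_scale e : 0 < e ->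
  lebesgue_tuple (ball e) = ((e ^+ r)%:E * lebesgue_tuple (ball 1))%E.
Proof.
move=> e0; have ei : 0 < e^-1 by rewrite invr_gt0.
have := lebesgue_tuple_affine (fun=> 0) ei (measurable_ball 1).
rewrite exprVn invrK => <-; congr (lebesgue_tuple _).
apply/seteqP; split=> y; rewrite /ball /preimage/= comb_affine comb0 addr0
  frobZ;
  by rewrite gtr0_norm// ler_pdivrMl// mulr1.
Qed.

(* A bound for the coordinates in the basis [b] in terms of the norm; it makes
   the unit ball bounded, hence of finite volume. *)
Let coercive : exists2 c, 0 <= c &
  forall (y : r.-tuple R) i, `|tnth y i| <= c * frob (comb y).
Proof.
pose c := \sum_(i < r) \sum_(a < p) \sum_(l < s) `|coord b i (delta_mx a l)|.
exists c => [|y i].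
  by do 3 (apply: sumr_ge0 => ? _).
have -> : tnth y i = coord b i (comb y).
  have <- := coord_sum_free (fun i => tnth y i) i (basis_free (vbasisP U)).
  by congr (coord b i _); apply: eq_bigr => l _; rewrite (tnth_nth 0 b).
rewrite {1}[comb y]matrix_sum_delta linear_sum.
apply: le_trans (ler_norm_sum _ _ _) _.
rewrite /c (bigD1 i)//= mulrDl -[leLHS]addr0; apply: lerD; last first.
  by rewrite mulr_ge0 ?frob_ge0//; do 3 (apply: sumr_ge0 => ? _).
rewrite mulr_suml; apply: ler_sum => a _.
rewrite linear_sum; apply: le_trans (ler_norm_sum _ _ _) _.
rewrite mulr_suml; apply: ler_sum => l _.
by rewrite linearZ/= normrM mulrC ler_wpM2l// entry_le_frob.
Qed.

Let ball1_fin : (lebesgue_tuple (ball 1) < +oo)%E.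
Proof.
have [c c0 cP] := coercive.
apply: (@le_lt_trans _ _ (lebesgue_tuple (@box R r
    (fun=> [set` `[- c, - c + 2 * c]])))); last first.
  by rewrite lebesgue_tuple_cube ?ltry// mulr_ge0.
apply: le_measure; rewrite ?inE//.
  by apply: measurable_box => i; exact: measurable_itv.
move=> y yb i /=; rewrite in_itv/=.
have : `|tnth y i| <= c.
  by apply: le_trans (cP y i) _; rewrite -[leRHS]mulr1 ler_wpM2l.
by rewrite ler_norml; lra.
Qed.

Let ball1_gt0 : (0 < lebesgue_tuple (ball 1))%E.
Proof.
pose c := 1 + \sum_(i < r) frob (tnth b i).
have c0 : 0 < c by rewrite ltr_wpDr// sumr_ge0// => i _; exact: frob_ge0.
apply: (@lt_le_trans _ _ (lebesgue_tuple (@box R r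
    (fun=> [set` `[0, 0 + c^-1]])))).
  by rewrite lebesgue_tuple_cube ?invr_ge0 ?(ltW c0)// lte_fin exprn_gt0
    ?invr_gt0.
apply: le_measure; rewrite ?inE//.
  by apply: measurable_box => i; exact: measurable_itv.
move=> y yb /=; rewrite /ball/= /comb.
have frob_sum (I : Type) (l : seq I) (M : I -> 'M[R]_(p, s)) :
    frob (\sum_(i <- l) M i) <= \sum_(i <- l) frob (M i).
  elim: l => [|i l IH]; first by rewrite !big_nil frob0.
  by rewrite !big_cons (le_trans (ler_frobD _ _))// lerD2l.
apply: le_trans (frob_sum _ _ _) _.
apply: (@le_trans _ _ (\sum_(i < r) c^-1 * frob (tnth b i))).
  apply: ler_sum => i _; rewrite frobZ ler_wpM2r ?frob_ge0//.
  by have := yb i; rewrite /= in_itv/= add0r => /andP[y0 y1]; rewrite ger0_norm.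
rewrite -mulr_sumr ler_pdivrMl// mulr1 /c lerDr//.
Qed.

(** The balls of radius [delta / 2] around the points are disjoint, have equal
    volumes by translation invariance, and lie in the ball of radius [kappa +
    delta / 2]; volumes of balls scale with the power [r]. *)
Lemma packing_bound K (Z : 'I_K -> 'M[R]_(p, s)) (kappa delta : R) :
  0 <= kappa -> 0 < delta ->
  (forall i, Z i \in U /\ frob (Z i) <= kappa) ->
  (forall i j, i != j -> delta < frob (Z i - Z j)) ->
  K%:R <= (1 + 2 * kappa / delta) ^+ r.
Proof.
move=> k0 d0 ZU Zsep.
have d2 : 0 < delta / 2 by rewrite divr_gt0.
pose F i := affine 1 (nth 0 (coords (- Z i))) @^-1` ball (delta / 2).
have FE i y : F i y = (frob (comb y - Z i) <= delta / 2).
  rewrite /F /preimage /ball/= comb_affine scale1r.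
  have -> : [tuple (coords (- Z i))`_i0 | i0 < r] = coords (- Z i).
    by apply: eq_from_tnth => l; rewrite tnth_mktuple -tnth_nth.
  rewrite coordsK//.
  by rewrite rpredN; case: (ZU i).
have mF i : measurable (F i).
  rewrite (_ : F i = [set y | frob (comb y - Z i) <= delta / 2]).
    apply: measurable_frob_le => a l.
    rewrite (_ : (fun t => _) = (fun t => comb t a l - Z i a l)).
      by apply: measurable_funB => //; exact: measurable_comb.
    by apply/funext => t; rewrite !mxE.
  by apply/funext => y; rewrite FE.
have tF : trivIset setT F.
  apply/trivIsetP => i j _ _ ij; apply/seteqP; split=> // y [].
  rewrite !FE => yi yj; have := Zsep i j ij.
  rewrite ltNge => /negP; apply.
  have -> : Z i - Z j = (comb y - Z j) - (comb y - Z i).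
    by rewrite opprB [RHS]addrC addrA subrK.
  apply: le_trans (ler_frobD _ _) _; rewrite frobN; lra.
have FV i : lebesgue_tuple (F i) = lebesgue_tuple (ball (delta / 2)).
  by rewrite lebesgue_tuple_affine// expr1n invr1 mul1e.
have e0 : 0 < kappa + delta / 2 by lra.
have : (lebesgue_tuple (\big[setU/set0]_(i < K) F i) <=
    lebesgue_tuple (ball (kappa + delta / 2)))%E.
  apply: le_measure; rewrite ?inE//; first exact: bigsetU_measurable.
  elim/big_ind : _ => [//|A B sA sB y [/sA|/sB] //|i _ y].
  rewrite FE /ball/= => yi.
  have -> : comb y = Z i + (comb y - Z i) by rewrite addrC subrK.
  apply: le_trans (ler_frobD _ _) _; apply: lerD => //.
  by case: (ZU i).
have ball1V : lebesgue_tuple (ball 1) = (fine (lebesgue_tuple (ball 1)))%:E.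
  by rewrite fineK ?ge0_fin_numE.
have : 0 < fine (lebesgue_tuple (ball 1)) by rewrite fine_gt0// ball1_gt0.
move: ball1V; set V := fine _ => ball1V V0.
rewrite measure_bigsetU_ord//.
rewrite (eq_bigr (fun=> ((delta / 2) ^+ r * V)%:E)); last first.
  by move=> i _; rewrite -[LHS]/(lebesgue_tuple (F i)) FV (ball_scale d2)
    ball1V.
rewrite (ball_scale e0) ball1V -EFinM sumEFin lee_fin sumr_const card_ord.
rewrite -mulrnAl ler_pM2r// -mulr_natl -ler_pdivlMr ?exprn_gt0//.
rewrite -expr_div_n => /le_trans; apply; rewrite le_eqVlt; apply/orP; left.
by apply/eqP; congr (_ ^+ _); field; lra.
Qed.

(** A [delta]-separated family of maximal cardinality is a [delta]-net, and
    [delta <= kappa] turns [1 + 2 * kappa / delta] into [3 * kappa / delta]. *)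
Lemma covering (kappa delta : R) : 0 < delta -> delta <= kappa ->
  exists s : seq 'M[R]_(p, s),
    [/\ (size s)%:R <= (3 * kappa / delta) ^+ r, {subset s <= U} &
    forall Z, Z \in U -> frob Z <= kappa ->
      exists2 Y, Y \in s & frob (Z - Y) <= delta].
Proof.
move=> d0 dk; have k0 : 0 <= kappa by lra.
pose sep K := `[< exists Z : 'I_K -> 'M[R]_(p, s),
  (forall i, Z i \in U /\ frob (Z i) <= kappa) /\
  (forall i j, i != j -> delta < frob (Z i - Z j)) >].
have sep0 : exists K, sep K.
  exists 0%N; apply/asboolP; exists (fun=> 0); split=> -[] //.
have bound0 : 0 <= (1 + 2 * kappa / delta) ^+ r.
  by rewrite exprn_ge0// addr_ge0// divr_ge0 ?mulr_ge0// ltW.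
have sep_bound K : sep K -> (K <= Num.bound ((1 + 2 * kappa / delta) ^+ r))%N.
  move=> /asboolP[Z [ZU Zsep]]; have := packing_bound k0 d0 ZU Zsep.
  move=> /le_lt_trans /(_ (archi_boundP bound0)).
  by rewrite ltr_nat => /ltnW.
case: (ex_maxnP sep0 sep_bound) => K /asboolP[Z [ZU Zsep]] Kmax.
exists [seq Z i | i <- enum 'I_K]; split=> [|_ /mapP[i _ ->]|X XU Xk].
- rewrite size_map size_enum_ord;
  apply: le_trans (packing_bound k0 d0 ZU Zsep) _.
  apply: lerXn2r; rewrite ?nnegrE.
  - by rewrite addr_ge0// divr_ge0 ?mulr_ge0// ltW.
  - by rewrite divr_ge0 ?mulr_ge0// ltW.
  by rewrite ler_pdivlMr// mulrDl divfK ?gt_eqF//; lra.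
- by case: (ZU i).
apply: contrapT => noY.
have Xsep i : delta < frob (X - Z i).
  rewrite ltNge; apply/negP => Xi; apply: noY; exists (Z i) => //.
  by apply: map_f; rewrite mem_enum.
suff /Kmax : sep K.+1 by rewrite ltnn.
apply/asboolP; exists (fun i => if unlift ord0 i is Some j then Z j else X).
split=> [i|i j]; first by case: unliftP.
case: (unliftP ord0 i) => [i' ->|->]; case: (unliftP ord0 j) => [j' ->|->] ij.
- by apply: Zsep; apply: contraNneq ij => ->.
- by rewrite frob_distC.
- exact: Xsep.
- by rewrite eqxx in ij.
Qed.

End covering.

(** * Maximal minors and approximate kernels *)

Section maximal_minor.
Context {R : realType}.

(** Cramer's rule, for one row: replacing row [j] of the square submatrix by row
    [i] of [V] does not change the cofactors along row [j]. *)
Lemma cramer_row n k (V : 'M[R]_(n, k)) (f : 'I_k -> 'I_n) i j :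
  (V *m \adj (rowsub f V)) i j =
  \det (rowsub (fun l => if l == j then i else f l) V).
Proof.
rewrite (expand_det_row _ j) mxE; apply: eq_bigr => l _.
rewrite !mxE eqxx /cofactor; congr (_ * (_ * \det _)).
by apply/matrixP => a c; rewrite !mxE eq_sym (negbTE (neq_lift _ _)).
Qed.

(** Each entry of [V *m invmx (rowsub f V)] is a quotient of two minors of [V]
    whose denominator is the one selected by [f]; so choose [f] to make it
    largest in modulus. *)
Lemma maximal_minor n k (V : 'M[R]_(n, k)) :
  (forall u : 'cV[R]_k, V *m u = 0 -> u = 0) ->
  exists f : 'I_k -> 'I_n, rowsub f V \in unitmx /\
    forall i j, `|(V *m invmx (rowsub f V)) i j| <= 1.
Proof.
move=> Vinj; have Vfull : row_full V.
  rewrite /row_full -mxrank_tr -[_ == _]/(row_free V^T) -kermx_eq0; apply/eqP.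
  apply/row_matrixP => i; rewrite row0; apply: trmx_inj; rewrite trmx0.
  apply: Vinj; apply: trmx_inj; rewrite trmx_mul trmxK trmx0.
  by apply/sub_kermxP; exact: row_sub.
pose D (f : {ffun 'I_k -> 'I_n}) := `|\det (rowsub f V)|.
pose f := [arg max_(g > fullrankfun Vfull) D g]%O.
have fmax g : D g <= D f by rewrite /f; case: arg_maxP => //= h _; exact.
have funit : rowsub f V \in unitmx.
  rewrite unitmxE unitfE -normr_gt0;
    apply: lt_le_trans (fmax (fullrankfun Vfull)).
  by rewrite normr_gt0 -unitfE -unitmxE fullrowsub_unit.
exists f; split=> // i j.
rewrite /invmx funit -scalemxAr mxE cramer_row normrM normfV.
have D0 : 0 < D f by rewrite normr_gt0 -unitfE -unitmxE.
rewrite ler_pdivrMl// mulr1.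
have := fmax [ffun l => if l == j then i else f l].
rewrite /D; congr (`|\det _| <= _).
by apply/matrixP => a b; rewrite !mxE ffunE.
Qed.

End maximal_minor.

Section near_singular.
Context {R : realType}.

(** The values 0 and 1 are kept exactly, because an approximate kernel vector
    has to keep its normalised entries. *)
Lemma rat_approx (x eta : R) : `|x| <= 1 -> 0 < eta ->
  exists q : rat, [/\ `|ratr q : R| <= 1, `|ratr q - x| <= eta,
    x = 0 -> q = 0 & x = 1 -> q = 1].
Proof.
move=> x1 eta0.
have [->|xN0] := eqVneq x 0.
  exists 0; rewrite rmorph0 normr0 subrr normr0; split=> //; first exact: ltW.
  by move/esym/eqP; rewrite oner_eq0.
have [->|xN1] := eqVneq x 1.
  exists 1; rewrite rmorph1 normr1 subrr normr0; split=> //; first exact: ltW.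
  by move/eqP; rewrite oner_eq0.
have : Num.max (- 1) (x - eta) < Num.min 1 (x + eta).
  rewrite lt_min !gt_max; apply/andP; split; apply/andP; split; try lra.
    by move: x1; rewrite ler_norml => /andP[? ?]; lra.
  by move: x1; rewrite ler_norml => /andP[? ?]; lra.
move=> /rat_in_itvoo[q]; rewrite in_itv/= gt_max lt_min.
move=> /andP[/andP[? ?] /andP[? ?]]; exists q; split.
- by rewrite ler_norml; lra.
- by rewrite ler_norml; lra.
- by move=> x0; rewrite x0 eqxx in xN0.
- by move=> x0; rewrite x0 eqxx in xN1.
Qed.

(** [M] has [k] approximate kernel vectors with entries of modulus at most 1,
    normalised to be the standard basis in the rows [f]. They are required to be
    rational, at no cost since the inequality is strict, so that the set is
    built from countably many measurable sets. *)
Definition near_singular n k (f : 'I_k -> 'I_n) (t : R) : set 'M[R]_n :=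
  [set M | forall j, exists w : 'cV[rat]_n,
    [/\ forall i, `|ratr (w i 0) : R| <= 1,
        forall a, w (f a) 0 = (a == j)%:R &
        frob (M *m map_mx ratr w) < t * Num.sqrt n%:R]].

Lemma frob_unit_entries n (w : 'cV[R]_n) (e : R) : 0 <= e ->
  (forall i, `|w i 0| <= e) -> frob w <= e * Num.sqrt n%:R.
Proof.
move=> e0 we; rewrite -(@ler_pXn2r _ 2)// ?nnegrE ?mulr_ge0 ?sqrtr_ge0
  ?frob_ge0//.
rewrite exprMn frob_sqE sqr_sqrtr// mulr_natr -[n in leRHS]card_ord -sumr_const.
apply: ler_sum => i _; rewrite big_ord1 -(real_normK (num_real _)).
by rewrite lerXn2r ?nnegrE.
Qed.

(** The columns of [V *m invmx (rowsub f V)], for a maximal minor [f], are such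
    vectors; they are then moved to nearby rational ones. *)
Lemma near_kernel_near_singular n k (M : 'M[R]_n) (V : 'M[R]_(n, k)) (t : R) :
  0 <= t ->
  (forall u : 'cV[R]_k, u != 0 -> frob (M *m (V *m u)) < t * frob (V *m u)) ->
  exists f : 'I_k -> 'I_n, near_singular f t M.
Proof.
move=> t0 MV.
have [u Vu0|f [funit W1]] := maximal_minor (V := V).
  apply/eqP/negPn/negP => /MV; rewrite Vu0 mulmx0 frob0 mulr0 ltxx//.
move: W1; have [W WE] : exists W, W = V *m invmx (rowsub f V) by eexists.
rewrite -WE => W1.
have Wf a j : W (f a) j = (a == j)%:R.
  rewrite WE; have -> : (V *m invmx (rowsub f V)) (f a) j =
    (rowsub f V *m invmx (rowsub f V)) a j.
    by rewrite mul_rowsub_mx [RHS]mxE.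
  by rewrite mulmxV// mxE.
exists f => j; pose w := col j W.
have Mw : frob (M *m w) < t * Num.sqrt n%:R.
  pose u := invmx (rowsub f V) *m (delta_mx j 0 : 'cV_k).
  have u0 : u != 0.
    apply/eqP => u0; have : rowsub f V *m u = delta_mx j 0 by rewrite mulKVmx.
    by rewrite u0 mulmx0 => /colP/(_ j); rewrite !mxE !eqxx => /esym/eqP;
      rewrite oner_eq0.
  have Vu : V *m u = w by rewrite mulmxA -WE -colE.
  move: u0 => /MV; rewrite Vu => /lt_le_trans; apply.
  rewrite ler_wpM2l// -[leRHS]mul1r; apply: frob_unit_entries => // i.
  by rewrite mxE.
(* Moving each entry of [w] by at most [eta] changes [M *m w] by less than the
   slack in the strict inequality [Mw]. *)
pose eta := (t * Num.sqrt n%:R - frob (M *m w)) / (2 * (1 +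
  frob M * Num.sqrt n%:R)).
have den0 : 0 < 1 + frob M * Num.sqrt n%:R.
  by rewrite ltr_wpDr// mulr_ge0 ?frob_ge0 ?sqrtr_ge0.
have eta0 : 0 < eta by rewrite divr_gt0 ?subr_gt0// mulr_gt0.
have /choice[q qP] i := rat_approx (W1 i j) eta0.
exists (\col_i q i); split=> [i|a|].
- by rewrite mxE; case: (qP i).
- rewrite mxE; case: (qP (f a)) => _ _ q0 q1; move: (Wf a j).
  by case: (a == j) => [/q1|/q0].
have -> : map_mx ratr (\col_i q i) =
  w + (map_mx ratr (\col_i q i) - w) by rewrite addrC subrK.
rewrite mulmxDr; apply: le_lt_trans (ler_frobD _ _) _.
rewrite -ltrBrDl; apply: le_lt_trans (frob_mulmx _ _) _.
apply: (@le_lt_trans _ _ (frob M * (eta * Num.sqrt n%:R))).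
  rewrite ler_wpM2l ?frob_ge0//; apply: frob_unit_entries => [|i];
    first exact: ltW.
  by rewrite !mxE; case: (qP i).
have : eta * (2 * (1 + frob M * Num.sqrt n%:R)) =
  t * Num.sqrt n%:R - frob (M *m w).
  by rewrite divfK// gt_eqF// mulr_gt0.
nra.
Qed.

Lemma near_singular_inj n k (f : 'I_k -> 'I_n) t M :
  near_singular f t M -> injective f.
Proof.
move=> Mf a b fab; have [w [_ wf _]] := Mf a.
by have := wf b; rewrite -fab wf eqxx; case: eqVneq.
Qed.

(** With [x] and [x'] the approximate kernel vectors of [M] and [M'] for [b] and
    [a], the normalisation in the rows [f] makes [x'^T (M - M') x] equal to the
    entry of [M - M'] in the block; and [x'^T M x] and [(M' x')^T x] are both at
    most [t * n] by the Cauchy-Schwarz inequality. *)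
Lemma near_singular_fibre n k (f : 'I_k -> 'I_n) (t : R) (M M' : 'M[R]_n) :
  0 <= t -> M'^T = M' -> near_singular f t M -> near_singular f t M' ->
  (forall i j, M i j != M' i j -> exists a b, i = f a /\ j = f b) ->
  forall a b, `|M (f a) (f b) - M' (f a) (f b)| <= 2 * t * n%:R.
Proof.
move=> t0 M's MB M'B MM' a b.
have [w' [w'1 w'f M'w']] := M'B a; have [w [w1 wf Mw]] := MB b.
set x' := map_mx ratr w' in M'w'; set x := map_mx ratr w in Mw.
have x'n : frob x' <= Num.sqrt n%:R.
  by rewrite -[leRHS]mul1r; apply: frob_unit_entries => // i; rewrite mxE.
have xn : frob x <= Num.sqrt n%:R.
  by rewrite -[leRHS]mul1r; apply: frob_unit_entries => // i; rewrite mxE.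
have -> : M (f a) (f b) - M' (f a) (f b) = ip x' (M *m x) - ip (M' *m x') x.
  have -> : ip (M' *m x') x = ip x' (M' *m x).
    by rewrite /ip trmx_mul M's mulmxA.
  have -> : ip x' (M *m x) - ip x' (M' *m x) = ip x' ((M - M') *m x).
    by rewrite mulmxBl ipBr.
  (* Only the row [f c] can contribute: elsewhere in the image of [f] the vector
     vanishes, and outside it [F] does. *)
  have fsupp (c : 'I_k) (v : 'cV[rat]_n) (F : 'I_n -> R) :
      (forall l, v (f l) 0 = (l == c)%:R) ->
      (forall i, F i != 0 -> exists l, i = f l) ->
      \sum_i ratr (v i 0) * F i = F (f c).
    move=> vf Ff; rewrite (bigD1 (f c))//= vf eqxx rmorph1 mul1r big1 ?addr0//
      => i ic.
    have [->|/Ff[l il]] := eqVneq (F i) 0; first by rewrite mulr0.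
    rewrite il vf; have /negbTE -> : l != c by apply: contraNneq ic => <-;
      rewrite il.
    by rewrite rmorph0 mul0r.
  have MM'E i : ((M - M') *m x) i 0 = (M - M') i (f b).
    rewrite mxE; under eq_bigr => l _ do rewrite mulrC [x _ _]mxE.
    apply: fsupp => // l; rewrite !mxE subr_eq0 => /MM'[_ [l' [_ ->]]].
    by exists l'.
  rewrite ipE; under eq_bigr => i _ do rewrite big_ord1 MM'E [x' _ _]mxE.
  rewrite (fsupp a w' (fun i => (M - M') i (f b))) ?mxE//.
  by move=> i; rewrite !mxE subr_eq0 => /MM'[l [_ [-> _]]]; exists l.
have sq : Num.sqrt n%:R * Num.sqrt n%:R = n%:R :> R by rewrite -expr2 sqr_sqrtr.
apply: le_trans (ler_normB _ _) _.
have := ip_le_frob x' (M *m x); have := ip_le_frob (M' *m x') x.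
have h1 : frob x' * frob (M *m x) <= Num.sqrt n%:R * (t * Num.sqrt n%:R).
  by apply: ler_pM; rewrite ?frob_ge0// ltW.
have h2 : frob (M' *m x') * frob x <= (t * Num.sqrt n%:R) * Num.sqrt n%:R.
  by apply: ler_pM; rewrite ?frob_ge0// ltW.
have e1 : Num.sqrt n%:R * (t * Num.sqrt n%:R) = t * n%:R by rewrite mulrCA sq.
have e2 : (t * Num.sqrt n%:R) * Num.sqrt n%:R = t * n%:R by rewrite -mulrA sq.
by lra.
Qed.

End near_singular.

(** * Coordinates of symmetric matrices *)

Section triangle.

Lemma tauS k : tau k.+1 = (tau k + k.+1)%N.
Proof.
rewrite /tau; have -> : (k.+1 * k.+2 = k * k.+1 + k.+1.*2)%N by lia.
by rewrite halfD odd_double andbF add0n doubleK.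
Qed.

Lemma tau_sum k : tau k = (\sum_(a < k) a.+1)%N.
Proof.
by elim: k => [|k IH]; [rewrite big_ord0|rewrite tauS IH big_ord_recr].
Qed.

Lemma leq_tau i j : (i <= j)%N -> (tau i <= tau j)%N.
Proof. by move=> ij; rewrite /tau half_leq// leq_mul. Qed.

(** The position of the entries (i, j) and (j, i) in the tuple that
    [sym_of_tuple] reads. *)
Definition tri (i j : nat) : nat := (tau (maxn i j) + minn i j)%N.

Lemma triC i j : tri i j = tri j i.
Proof. by rewrite /tri maxnC minnC. Qed.

Lemma tri_lt n i j : (i < n)%N -> (j < n)%N -> (tri i j < tau n)%N.
Proof.
move=> i_n j_n; have mn : (maxn i j < n)%N by rewrite gtn_max i_n.
by apply: leq_trans _ (leq_tau mn); rewrite tauS /tri; lia.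
Qed.

Lemma tri_inj i j i' j' : tri i j = tri i' j' ->
  maxn i j = maxn i' j' /\ minn i j = minn i' j'.
Proof.
rewrite /tri => E.
have [lt|lt|eq] := ltngtP (maxn i j) (maxn i' j').
- by have := leq_tau lt; rewrite tauS; lia.
- by have := leq_tau lt; rewrite tauS; lia.
- by rewrite eq in E; split=> //; lia.
Qed.

(** The coordinates of the block f x f of a symmetric matrix. *)
Definition tri_block n k (f : 'I_k -> 'I_n) : pred nat :=
  fun l => [exists a : 'I_k, [exists b : 'I_k, tri (f a) (f b) == l]].

Lemma tri_blockP n k (f : 'I_k -> 'I_n) (i j : 'I_n) :
  reflect (exists a b, i = f a /\ j = f b) (tri_block f (tri i j)).
Proof.
apply: (iffP existsP) => [[a /existsP[b /eqP /tri_inj[E1 E2]]]|].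
  have [[/val_inj E /val_inj E']|[/val_inj E /val_inj E']] :
      (f a = i :> nat /\ f b = j :> nat) \/ (f a = j :> nat /\ f b = i :> nat).
    by lia.
  - by exists a, b.
  - by exists b, a.
by move=> [a [b [-> ->]]]; exists a; apply/existsP; exists b.
Qed.

Lemma card_tri_block n k (f : 'I_k -> 'I_n) : injective f ->
  #|[pred l : 'I_(tau n) | tri_block f l]| = tau k.
Proof.
move=> f_inj.
pose D := [set p : 'I_k * 'I_k | (p.2 <= p.1)%N]%SET.
pose g (p : 'I_k * 'I_k) : 'I_(tau n) :=
  Ordinal (tri_lt (ltn_ord (f p.1)) (ltn_ord (f p.2))).
have -> : #|[pred l : 'I_(tau n) | tri_block f l]| = #|(g @: D)%SET|.
  apply: eq_card => l; rewrite inE;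
    apply/existsP/imsetP => [[a /existsP[b /eqP E]]|[p _ ->]].
    have [ba|ab] := leqP b a.
      by exists (a, b); [rewrite inE|apply: val_inj].
    by exists (b, a); [rewrite inE/= ltnW|apply: val_inj; rewrite /= triC].
  by exists p.1; apply/existsP; exists p.2.
rewrite card_in_imset => [|[a b] [a' b']]; last first.
  rewrite !inE/= => ba ba' [/tri_inj/= [E1 E2]].
  have [[/val_inj/f_inj -> /val_inj/f_inj ->]//|] :
      (f a = f a' :> nat /\ f b = f b' :> nat) \/ (f a = f b' :> nat /\ f b =
        f a' :> nat).
    by lia.
  move=> [/val_inj/f_inj E /val_inj/f_inj E']; subst.
  by have -> : a' = b' by apply/val_inj/eqP; rewrite eqn_leq ba ba'.
rewrite tau_sum -sum1_card.
rewrite (eq_bigl (fun p : 'I_k * 'I_k => true && (p.2 <= p.1)%N)); last first.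
  by move=> p; rewrite inE.
rewrite -(pair_big_dep xpredT (fun a b : 'I_k => (b <= a)%N) (fun _ _ =>
  1%N))/=.
apply: eq_bigr => a _; rewrite -[RHS]card_ord -sum1_card.
by rewrite -(big_ord_widen k (fun=> 1%N) (ltn_ord a)) sum1_card.
Qed.

Lemma tri_surj n (l : 'I_(tau n)) : exists i j : 'I_n, tri i j = l.
Proof.
have := card_tri_block (@inj_id 'I_n);
  rewrite -[RHS]card_ord => /subset_cardP E.
have := E (subset_predT _) l.
rewrite !inE => /existsP[i /existsP[j /eqP ij]]; exists i, j; exact: ij.
Qed.

End triangle.

Section measurability.
Context {R : realType}.

Lemma measurable_entry p r (i : 'I_p) (j : 'I_r) :
  measurable_fun [set: 'M[R]_(p, r)] (fun M => M i j).
Proof.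
rewrite (_ : (fun M => _) = (fun M : 'M[R]_(p, r) =>
  mxvec M ord0 (mxvec_index i j))); last first.
  by apply/funext => M; rewrite mxvecE.
move=> _ Y mY; rewrite setTI; apply: sub_sigma_algebra => /=.
rewrite -bigcup_seq/=; exists (mxvec_index i j) => /=;
  first by rewrite mem_index_enum.
by exists Y => //; rewrite setTI.
Qed.

Lemma measurable_nth N l : measurable_fun [set: N.-tuple R] (fun t =>
  nth 0 t l).
Proof.
have [lN|Nl] := ltnP l N; last first.
  by rewrite (_ : (fun t => _) = cst 0)//; apply/funext => t;
    rewrite nth_default// size_tuple.
rewrite (_ : (fun t => _) = (fun t : N.-tuple R => tnth t (Ordinal lN))).
  exact: measurable_tnth.
by apply/funext => t; rewrite (tnth_nth 0).
Qed.

Lemma measurable_near_singular d (T : measurableType d) n k (f : 'I_k -> 'I_n)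
    (t : R) (F : T -> 'M[R]_n) :
  (forall i j, measurable_fun setT (fun x => F x i j)) ->
  measurable [set x | near_singular f t (F x)].
Proof.
move=> mF.
pose P j (w : 'cV[rat]_n) := (forall i, `|ratr (w i 0) : R| <= 1) /\
  (forall a, w (f a) 0 = (a == j)%:R).
pose G j w := [set x | P j w /\ frob (F x *m map_mx ratr w) < t * Num.sqrt
  n%:R].
have -> : [set x | near_singular f t (F x)] =
    \bigcap_(j in [set: 'I_k]) \bigcup_w G j w.
  apply/seteqP; split=> x h j => [_|]; last first.
    by case: (h j I) => w _ [[? ?] ?]; exists w.
  by case: (h j) => w [? ? ?]; exists w.
apply: fin_bigcap_measurable => // j _.
apply: countable_bigcupT_measurable => [|w]; first exact: countableP.
have [Pw|nPw] := pselect (P j w); last first.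
  rewrite (_ : G j w = set0)//; apply/seteqP; split=> x //= -[].
  by move=> /nPw.
have mG : measurable_fun setT (fun x => frob (F x *m map_mx ratr w)).
  apply: measurable_frob => i l.
  rewrite (_ : (fun x => _) = fun x => \sum_a F x i a * ratr (w a l)).
    by apply: measurable_sum => a; apply: measurable_funM.
  by apply/funext => x; rewrite !mxE; apply: eq_bigr => a _; rewrite mxE.
rewrite (_ : G j w = (fun x => frob (F x *m map_mx ratr w)) @^-1`
   [set` `]-oo, t * Num.sqrt n%:R[]).
  by rewrite -[X in measurable X]setTI; apply: mG => //; exact: measurable_itv.
by apply/seteqP; split=> x /=; rewrite in_itv/=; [case|split].
Qed.

End measurability.

(** * Probability of an approximate kernel *)

Section near_singular_volume.
Context {R : realType}.

(** The function lives on all of [nat] because [affine] and [box] take such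
    functions. *)
Lemma sym_entries n (M : 'M[R]_n) : M^T = M ->
  exists m : nat -> R, forall i j : 'I_n, M i j = m (tri i j).
Proof.
move=> Ms.
exists (fun l => if [pick p : 'I_n * 'I_n | tri p.1 p.2 == l] is Some p
  then M p.1 p.2 else 0) => i j.
case: pickP => [[a b] /= /eqP /tri_inj[E1 E2]|/(_ (i, j))];
  last by rewrite eqxx.
have [[/val_inj -> /val_inj ->]//|[/val_inj -> /val_inj ->]] :
    (a = i :> nat /\ b = j :> nat) \/ (a = j :> nat /\ b = i :> nat) by lia.
by rewrite -[in LHS]Ms mxE.
Qed.

Lemma sym_of_tuple_sym n (t : (tau n).-tuple R) :
  (@sym_of_tuple R n t)^T = sym_of_tuple t.
Proof. by apply/matrixP => i j; rewrite !mxE maxnC minnC. Qed.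

Lemma sym_of_tupleE n (t : (tau n).-tuple R) i j :
  @sym_of_tuple R n t i j = nth 0 t (tri i j).
Proof. by rewrite mxE. Qed.

Lemma measurable_sym_of_tuple_entry n i j :
  measurable_fun setT (fun t => @sym_of_tuple R n t i j).
Proof.
rewrite (_ : (fun t => _) = (fun t : (tau n).-tuple R => nth 0 t (tri i j))).
  exact: measurable_nth.
by apply/funext => t; rewrite sym_of_tupleE.
Qed.

Lemma sym_of_tuple_ball n (Cbar : 'M[R]_n) (sigma : R) :
  @sym_of_tuple R n @^-1` sym_ball Cbar sigma =
  [set s | frob (sym_of_tuple s - Cbar) <= sigma].
Proof.
by apply/seteqP; split=> s; [case|split=> //; exact: sym_of_tuple_sym].
Qed.

Lemma measurable_sym_ball n (Cbar : 'M[R]_n) (sigma : R) :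
  measurable [set s | frob (@sym_of_tuple R n s - Cbar) <= sigma].
Proof.
apply: measurable_frob_le => i j.
rewrite (_ : (fun t => _) = (fun t => sym_of_tuple t i j - Cbar i j)).
  by apply: measurable_funB => //; exact: measurable_sym_of_tuple_entry.
by apply/funext => t; rewrite !mxE.
Qed.

Lemma nth_affine N rho v (s : N.-tuple R) l : (l < N)%N ->
  nth 0 (affine rho v s) l = rho * nth 0 s l + v l.
Proof.
move=> lN; have := @tnth_mktuple _ _ (fun i =>
  rho * tnth s i + v i) (Ordinal lN).
by rewrite (tnth_nth 0) (tnth_nth 0 s).
Qed.

Lemma lebesgue_sym_ball_fin n (Cbar : 'M[R]_n) (sigma : R) :
  0 <= sigma -> Cbar^T = Cbar -> (lebesgue_sym (sym_ball Cbar sigma) < +oo)%E.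
Proof.
move=> s0 /sym_entries[cb cbE]; rewrite /lebesgue_sym /pushforward
  sym_of_tuple_ball.
have s20 : 0 <= 2 * sigma by rewrite mulr_ge0.
pose Q := @box R (tau n) (fun l =>
  [set` `[cb l - sigma, cb l - sigma + 2 * sigma]]).
apply: (@le_lt_trans _ _ (lebesgue_tuple Q)); last first.
  by rewrite lebesgue_tuple_cube// ltry.
apply: le_measure; rewrite ?inE.
- exact: measurable_sym_ball.
- by apply: measurable_box => i; exact: measurable_itv.
move=> s /= sB l.
have [i [j ijl]] := tri_surj l.
have := le_trans (entry_le_frob (sym_of_tuple s - Cbar) i j) sB.
rewrite /= in_itv/= (tnth_nth 0) 2!mxE [(- Cbar) _ _]mxE cbE -/(tri i j) ijl
  ler_norml.
by move=> /andP[? ?]; apply/andP; split; lra.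
Qed.

(** This is the price of shrinking by [rho = n / sqrt (n ^ 2 + 1)] in dimension
    [tau n <= n ^ 2]: already [(1 + 1 / n ^ 2) ^ tau n] is at most [e]. *)
Lemma scale_pow_le_e (n : nat) : (0 < n)%N ->
  (n%:R / Num.sqrt (n%:R ^+ 2 + 1) : R) ^- tau n <= expR 1.
Proof.
move=> n0; have n0R : 0 < n%:R :> R by rewrite ltr0n.
set q := n%:R ^+ 2 + 1; have q0 : 0 < q :> R by rewrite ltr_wpDl ?exprn_ge0.
set x := Num.sqrt q / n%:R.
have -> : n%:R / Num.sqrt q = x^-1 by rewrite invf_div.
have x2 : x ^+ 2 = 1 + (n%:R ^+ 2)^-1.
  by rewrite expr_div_n sqr_sqrtr ?ltW// mulrDl divff ?mul1r// gt_eqF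
    ?exprn_gt0.
have x0 : 0 <= x by rewrite divr_ge0 ?sqrtr_ge0// ltW.
have x1 : 1 <= x.
  by rewrite -(@ler_pXn2r _ 2)// ?nnegrE// expr1n x2 lerDl invr_ge0 exprn_ge0//
    ltW.
rewrite exprVn invrK.
apply: (@le_trans _ _ ((x ^+ 2) ^+ tau n)).
  by rewrite -exprM ler_weXn2l// mul2n -addnn leq_addr.
rewrite x2; apply: (@le_trans _ _ (expR ((n%:R ^+ 2)^-1) ^+ tau n)).
  by rewrite lerXn2r ?nnegrE ?addr_ge0 ?invr_ge0 ?exprn_ge0 ?expR_ge0
    ?expR_ge1Dx.
rewrite -expRM_natl ler_expR ler_pdivrMr ?exprn_gt0// mul1r -natrX ler_nat.
rewrite /tau; nia.
Qed.

(** By [near_singular_fibre] the fibres of the set along the block f x f have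
    diameter at most [2 * t * n]. The set is first shrunk towards [Cbar] by
    [rho]. A point whose block coordinates are then replaced by coordinates
    within [h / 2] of those of [Cbar] is still in the ball: the block has at
    most [k ^ 2] entries, so the squared distance to [Cbar] is at most [k ^ 2 *
    h ^ 2 / 4 + rho ^ 2 * sigma ^ 2 = sigma ^ 2]. *)
Lemma near_singular_volume n k (f : 'I_k -> 'I_n) (Y Cbar : 'M[R]_n) (sigma t :
  R) :
  (0 < n)%N -> (0 < k)%N -> Y^T = Y -> Cbar^T = Cbar -> 0 < sigma -> 0 <= t ->
  (lebesgue_sym ([set D | near_singular f t (D - Y)%R] `&` sym_ball Cbar sigma)
   <= (expR 1 * (t * n%:R ^+ 2 * k%:R / sigma) ^+ tau k)%:E *
      lebesgue_sym (sym_ball Cbar sigma))%E.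
Proof.
move=> n0 k0 Ys Cs s0 t0.
have n0R : 0 < n%:R :> R by rewrite ltr0n.
have k0R : 0 < k%:R :> R by rewrite ltr0n.
have n2 : 0 < n%:R ^+ 2 + 1 :> R by rewrite ltr_wpDl ?exprn_ge0.
rewrite /lebesgue_sym /pushforward preimage_setI sym_of_tuple_ball.
set B' := [set s | frob (sym_of_tuple s - Cbar) <= sigma].
set B := _ `&` B'.
have [finj|fninj] := pselect (injective f); last first.
  suff -> : B = set0.
    by rewrite measure0 mule_ge0// lee_fin !mulr_ge0// exprn_ge0// divr_ge0
      ?mulr_ge0// ltW.
  by apply/seteqP; split=> s // -[/near_singular_inj].
have mB' : measurable B' by exact: measurable_sym_ball.
have mB : measurable B.
  apply: measurableI => //; apply: measurable_near_singular => i j.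
  rewrite (_ : (fun t => _) = (fun t => sym_of_tuple t i j - Y i j)).
    by apply: measurable_funB => //; exact: measurable_sym_of_tuple_entry.
  by apply/funext => s; rewrite !mxE.
have [cb cbE] := sym_entries Cs.
pose rho : R := n%:R / Num.sqrt (n%:R ^+ 2 + 1).
have rho0 : 0 < rho by rewrite divr_gt0 ?sqrtr_gt0.
have rho2 : rho ^+ 2 * (1 + (n%:R ^+ 2)^-1) = 1.
  rewrite expr_div_n sqr_sqrtr ?ltW//.
  by field; rewrite !gt_eqF// exprn_gt0.
pose K := tri_block f.
pose h := 2 * sigma * rho / (n%:R * k%:R).
have h0 : 0 < h by rewrite divr_gt0 ?mulr_gt0.
(* [affine rho^-1 v] expands by [rho^-1] from the centre, so that the preimage
   [B1] is the shrunk set. *)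
pose v (l : nat) : R := (1 - rho^-1) * cb l.
pose B1 := affine rho^-1 v @^-1` B.
have B1vol : lebesgue_tuple B1 = ((rho ^+ tau n)%:E * lebesgue_tuple B)%E.
  by rewrite /B1 lebesgue_tuple_affine ?invr_gt0// exprVn invrK.
have mB1 : measurable B1.
  by rewrite -[X in measurable X]setTI; exact: measurable_affine_tuple.
have triN (i j : 'I_n) : (tri i j < tau n)%N by exact: tri_lt.
have L0 : 0 <= rho * (2 * t * n%:R) by rewrite mulr_ge0 ?(ltW rho0)//
  !mulr_ge0// ltW.
have := @lebesgue_tuple_fibre R (tau n) K B1 B' (rho * (2 * t * n%:R)) h
  (fun l => cb l - h / 2) mB1 mB' L0 h0.
rewrite card_tri_block// => fib0.
have fib : (lebesgue_tuple B1 * (h ^+ tau k)%:E <=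
  lebesgue_tuple B' * ((rho * (2 * t * n%:R)) ^+ tau k)%:E)%E.
  have subE (M1 M2 : 'M[R]_n) i j :
    (M1 - M2) i j = M1 i j - M2 i j by rewrite !mxE.
  have affE (w : (tau n).-tuple R) (i j : 'I_n) :
    sym_of_tuple (affine rho^-1 v w) i j =
      rho^-1 * nth 0 w (tri i j) + v (tri i j).
    by rewrite sym_of_tupleE nth_affine ?triN.
  apply: fib0 => [s u [sB _] [uB _] su l Kl|s u [_ uB] su sK].
    have /existsP[a /existsP[b /eqP abl]] := Kl.
    have M's : (sym_of_tuple (affine rho^-1 v u) - Y)^T =
      sym_of_tuple (affine rho^-1 v u) - Y.
      by rewrite raddfB /= sym_of_tuple_sym Ys.
    have Mdiff i j : (sym_of_tuple (affine rho^-1 v s) - Y) i j -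
        (sym_of_tuple (affine rho^-1 v u) - Y) i j =
        rho^-1 * (nth 0 s (tri i j) - nth 0 u (tri i j)).
      by rewrite !subE !affE; ring.
    have Moff i j : (sym_of_tuple (affine rho^-1 v s) - Y) i j !=
        (sym_of_tuple (affine rho^-1 v u) - Y) i j -> exists a b,
          i = f a /\ j = f b.
      rewrite -subr_eq0 Mdiff => Mij; apply/tri_blockP;
        apply: contraNT Mij => Kij.
      have := su (Ordinal (triN i j)) Kij; rewrite !(tnth_nth 0)/= => ->.
      by rewrite subrr mulr0.
    have := near_singular_fibre t0 M's sB uB Moff a b.
    rewrite Mdiff abl normrM gtr0_norm ?invr_gt0// ler_pdivrMl//.
    by rewrite !(tnth_nth 0).
  rewrite /B'/= -(@ler_pXn2r _ 2)// ?nnegrE ?frob_ge0 ?(ltW s0)//.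
  pose E (i j : 'I_n) : R := if K (tri i j) then h ^+ 2 / 4 else 0.
  have ent (i j : 'I_n) : (sym_of_tuple s - Cbar) i j ^+ 2 <=
      E i j + rho ^+ 2 * (sym_of_tuple (affine rho^-1 v u) - Cbar) i j ^+ 2.
    have -> : rho ^+ 2 * (sym_of_tuple (affine rho^-1 v u) - Cbar) i j ^+ 2 =
        (nth 0 u (tri i j) - cb (tri i j)) ^+ 2.
      rewrite subE affE cbE -exprMn; congr (_ ^+ 2).
      rewrite /v; field; rewrite gt_eqF//.
    rewrite subE sym_of_tupleE cbE /E; case: ifPn => Kij.
      have := sK (Ordinal (triN i j)) Kij;
        rewrite (tnth_nth 0)/= => /andP[h1 h2].
      apply: ler_wpDr; first exact: sqr_ge0.
      rewrite (_ : h ^+ 2 / 4 = (h / 2) ^+ 2); last by field.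
      have hb : `|nth 0 s (tri i j) - cb (tri i j)| <=
        h / 2 by rewrite ler_norml; lra.
      by rewrite -(real_normK (num_real (_ - _))) lerXn2r ?nnegrE// (le_trans _
        hb).
    by have := su (Ordinal (triN i j)) Kij; rewrite !(tnth_nth 0)/= => ->;
      rewrite add0r.
  have Esum : \sum_i \sum_j E i j <= k%:R ^+ 2 * (h ^+ 2 / 4).
    rewrite pair_bigA/= -big_mkcond/= sumr_const -[leLHS]mulr_natl.
    rewrite ler_wpM2r ?divr_ge0 ?sqr_ge0// -natrX ler_nat.
    apply: (@leq_trans #|[set (f p.1, f p.2) | p in [set: 'I_k * 'I_k]]%SET|).
      apply/subset_leq_card/fintype.subsetP =>
        -[i j] /tri_blockP[a [b /= [-> ->]]].
      by apply/imsetP; exists (a, b); rewrite ?finset.inE.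
    by rewrite (leq_trans (leq_imset_card _ _))// cardsT card_prod card_ord.
  have uB2 : frob (sym_of_tuple (affine rho^-1 v u) - Cbar) ^+ 2 <= sigma ^+ 2.
    by rewrite lerXn2r ?nnegrE ?frob_ge0// ltW.
  rewrite frob_sqE; apply: (@le_trans _ _ (\sum_i \sum_j (E i j +
      rho ^+ 2 * (sym_of_tuple (affine rho^-1 v u) - Cbar) i j ^+ 2))).
    by apply: ler_sum => i _; apply: ler_sum => j _; exact: ent.
  under eq_bigr do rewrite big_split/= -mulr_sumr.
  rewrite big_split/= -mulr_sumr -frob_sqE.
  apply: (@le_trans _ _ (k%:R ^+ 2 * (h ^+ 2 / 4) + rho ^+ 2 * sigma ^+ 2)).
    by apply: lerD => //; rewrite ler_wpM2l// sqr_ge0.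
  rewrite -[leRHS]mul1r -[X in _ <= X * _]rho2 /h le_eqVlt; apply/orP; left;
    apply/eqP.
  by field; rewrite !gt_eqF.
rewrite B1vol in fib.
set c := _ * _ ^+ tau k.
pose a := rho ^+ tau n * h ^+ tau k.
have a0 : 0 < a by rewrite mulr_gt0// exprn_gt0.
have ca : (rho * (2 * t * n%:R)) ^+ tau k <= c * a.
  have -> : rho * (2 * t * n%:R) = (t * n%:R ^+ 2 * k%:R / sigma) * h.
    by rewrite /h; field; rewrite !gt_eqF.
  rewrite exprMn /c /a; set X := _ ^+ tau k; set H := h ^+ tau k.
  have -> : expR 1 * X * (rho ^+ tau n * H) =
    (X * H) * (expR 1 * rho ^+ tau n) by ring.
  rewrite ler_peMr//.
    by rewrite mulr_ge0// exprn_ge0 ?(ltW h0)// divr_ge0 ?mulr_ge0// ltW.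
  by rewrite -ler_pdivrMr ?exprn_gt0// mul1r; exact: scale_pow_le_e.
rewrite -(@lee_pmul2r _ a%:E)// muleAC -EFinM.
apply: (@le_trans _ _ (lebesgue_tuple B' * ((rho * (2 * t * n%:R)) ^+ tau
  k)%:E)%E).
  by move: fib; rewrite /a EFinM muleA [(lebesgue_tuple B * _)%E]muleC.
by rewrite muleC lee_wpmul2r// lee_fin.
Qed.

End near_singular_volume.

Section uniform_bound.
Context {R : realType}.

Lemma uniform_near_singular n k (f : 'I_k -> 'I_n) (Y Cbar :
  'M[R]_n) (sigma t : R) :
  (0 < n)%N -> (0 < k)%N -> Y^T = Y -> Cbar^T = Cbar -> 0 < sigma -> 0 <= t ->
  (uniform_sym_ball Cbar sigma [set D | near_singular f t (D - Y)%R] <=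
   (expR 1 * (t * n%:R ^+ 2 * k%:R / sigma) ^+ tau k)%:E)%E.
Proof.
move=> n0 k0 Ys Cs s0 t0.
have := near_singular_volume f n0 k0 Ys Cs s0 t0.
have := lebesgue_sym_ball_fin (ltW s0) Cs.
rewrite /uniform_sym_ball lee_fin.
set b := lebesgue_sym (sym_ball _ _); set a := lebesgue_sym (_ `&` _);
  set c := _ * _.
have a0 : (0 <= a)%E by exact: (measure_ge0 (@lebesgue_tuple R (tau n)) _).
have b0 : (0 <= b)%E by exact: (measure_ge0 (@lebesgue_tuple R (tau n)) _).
have c0 : 0 <= c.
  by rewrite mulr_ge0 ?expR_ge0// exprn_ge0// divr_ge0 ?mulr_ge0// ltW.
case: b b0 => [b| |]//; rewrite lee_fin => b0 _.
case: a a0 => [a| |]//; rewrite lee_fin => a0; rewrite lee_fin/= => acb.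
have [->|bN0] := eqVneq b 0; first by rewrite invr0 mulr0.
by rewrite ler_pdivrMr// lt_neqAle eq_sym bN0.
Qed.

Lemma sqrn_le_expn2 k : (k ^ 2 <= 2 ^ k.+1)%N.
Proof.
have [|k4] := ltnP k 4; first by case: k => [|[|[|[|]]]].
elim: k k4 => // k IH; rewrite leq_eqVlt => /orP[/eqP <- //|k4].
have := IH k4; rewrite [(2 ^ k.+2)%N]expnS; nia.
Qed.

Lemma leq_expn2r m n e : (m <= n)%N -> (m ^ e <= n ^ e)%N.
Proof. by case: e => // e mn; rewrite leq_exp2r. Qed.

Lemma expnn_le_expn2_tau k : (k ^ k <= 2 ^ tau k)%N.
Proof.
rewrite -(@leq_exp2r _ _ 2)// -!expnM.
have -> : (tau k * 2 = k.+1 * k)%N.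
  by elim: k => // k IH; rewrite tauS; nia.
by rewrite mulnC !expnM leq_expn2r// sqrn_le_expn2.
Qed.

Lemma leq_tau_id k : (k <= tau k)%N.
Proof. by case: k => // k; rewrite tauS leq_addl. Qed.

(** The number [n ^ k] of maps [f] is absorbed by the factor [2 ^ tau k]: as [k
    <= n], it is enough that [k ^ k <= 2 ^ tau k], which is the square root of
    [(k ^ 2) ^ k <= (2 ^ k.+1) ^ k]. *)
Lemma count_minors n k : (k <= n)%N -> (n ^ k * k ^ tau k <= (2 * n) ^ tau k)%N.
Proof.
move=> kn; rewrite -[in (k ^ tau k)%N](subnKC (leq_tau_id k)) expnD mulnCA
  mulnA.
rewrite expnMn -[in (n ^ tau k)%N](subnKC (leq_tau_id k)) expnD.
rewrite -mulnA; apply: leq_mul; first exact: expnn_le_expn2_tau.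
by rewrite leq_mul2l leq_expn2r ?orbT.
Qed.

Lemma count_minors_bound n k (delta sigma : R) : (k <= n)%N ->
  0 <= delta -> 0 < sigma ->
  (n ^ k)%:R * (2 * delta * n%:R ^+ 2 * k%:R / sigma) ^+ tau k <=
  (4 * n%:R ^+ 3 * delta / sigma) ^+ tau k.
Proof.
move=> kn d0 s0.
have -> : 2 * delta * n%:R ^+ 2 * k%:R / sigma =
  k%:R * (2 * n%:R ^+ 2 * delta / sigma).
  by field; rewrite gt_eqF.
have -> : 4 * n%:R ^+ 3 * delta / sigma =
  (2 * n)%:R * (2 * n%:R ^+ 2 * delta / sigma).
  by rewrite natrM; field; rewrite gt_eqF.
set X := 2 * _ * _ / _.
rewrite [(k%:R * X) ^+ _]exprMn [((2 * n)%:R * X) ^+ _]exprMn mulrA ler_wpM2r//.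
  by rewrite exprn_ge0// divr_ge0 ?mulr_ge0 ?exprn_ge0// ltW.
by rewrite -!natrX -natrM ler_nat count_minors.
Qed.

End uniform_bound.

(** * The constraint operators *)

Section constraint_operator.
Context {R : realType} {m p : nat} (A : 'I_m -> 'M[R]_p).

Lemma Aadj_is_linear : linear (Aadj A).
Proof.
move=> a x y; rewrite /Aadj scaler_sumr -big_split/=; apply: eq_bigr => i _.
by rewrite !mxE scalerDl scalerA.
Qed.

HB.instance Definition _ :=
  GRing.isLinear.Build R 'cV[R]_m 'M[R]_p _ (Aadj A) Aadj_is_linear.

Lemma ip_Aadj y X : ip (Aadj A y) X = ip y (Aop A X).
Proof.
rewrite [RHS]ipE /Aadj /ip linear_sum/= mulmx_suml linear_sum/=.
by apply: eq_bigr => i _; rewrite big_ord1 mxE linearZ/= -scalemxAl mxtraceZ.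
Qed.

Lemma Anorm_set_sup :
  has_sup [set frob (Aop A X) | X in [set X :
    'M[R]_p | X^T = X /\ frob X <= 1]].
Proof.
split; first by exists (frob (Aop A 0)), 0 => //=; rewrite trmx0 frob0.
pose e := \sum_i frob (A i); exists (e * Num.sqrt m%:R) => _ [X [_ X1] <-].
apply: frob_unit_entries => [|i]; first by rewrite sumr_ge0// => i _;
  exact: frob_ge0.
rewrite mxE; apply: le_trans (ip_le_frob (A i) X) _.
apply: (@le_trans _ _ (frob (A i))).
  by rewrite -[leRHS]mulr1 ler_wpM2l ?frob_ge0.
by rewrite /e (bigD1 i)//= lerDl sumr_ge0// => j _; exact: frob_ge0.
Qed.

Lemma Aop_le_Anorm_sym X : X^T = X -> frob (Aop A X) <= Anorm A * frob X.
Proof.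
move=> Xs; have [->|X0] := eqVneq X 0; first by rewrite linear0 !frob0 mulr0.
have x0 : 0 < frob X by rewrite frob_gt0.
rewrite -ler_pdivrMr//.
have -> : frob (Aop A X) / frob X = frob (Aop A ((frob X)^-1 *: X)).
  by rewrite linearZ/= frobZ gtr0_norm ?invr_gt0// mulrC.
apply: ub_le_sup; first by case: Anorm_set_sup.
exists ((frob X)^-1 *: X) => //=; split; first by rewrite linearZ/= Xs.
by rewrite frobZ gtr0_norm ?invr_gt0// mulVf ?gt_eqF.
Qed.

Lemma Anorm_ge0 : 0 <= Anorm A.
Proof.
apply: (@le_trans _ _ (frob (Aop A 0))); first exact: frob_ge0.
apply: ub_le_sup; first by case: Anorm_set_sup.
by exists 0 => //=; rewrite trmx0 frob0.
Qed.

Hypothesis A_sym : forall i, (A i)^T = A i.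

Lemma Aop_tr X : Aop A X^T = Aop A X.
Proof.
apply/colP => i; rewrite !mxE -trmx_mul mxtrace_tr mxtrace_mulC.
by rewrite A_sym.
Qed.

(** The supremum is over symmetric matrices, but [Aop A] only sees the symmetric
    part of its argument, whose norm is no larger. The case needed is that of
    the rank-one matrices in [escape]. *)
Lemma Aop_le_Anorm X : frob (Aop A X) <= Anorm A * frob X.
Proof.
have -> : Aop A X = Aop A (2^-1 *: (X + X^T)).
  rewrite linearZ/= linearD/= Aop_tr scalerDr -scalerDl.
  by rewrite (_ : 2^-1 + 2^-1 = 1) ?scale1r//; field.
apply: le_trans (Aop_le_Anorm_sym _) _.
  by rewrite linearZ/= linearD/= trmxK addrC.
rewrite ler_wpM2l ?Anorm_ge0// frobZ gtr0_norm ?invr_gt0//.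
by have := ler_frobD X X^T; rewrite frob_tr; lra.
Qed.

Lemma Aadj_le_Anorm y : frob (Aadj A y) <= Anorm A * frob y.
Proof.
have [->|Y0] := eqVneq (Aadj A y) 0.
  by rewrite frob0 mulr_ge0 ?Anorm_ge0 ?frob_ge0.
rewrite -(@ler_pM2r _ (frob (Aadj A y))) ?frob_gt0//.
rewrite -expr2 -ip_frob ip_Aadj.
apply: le_trans (le_trans (ler_norm _) (ip_le_frob _ _)) _.
rewrite -mulrA mulrCA ler_wpM2l ?frob_ge0//; exact: Aop_le_Anorm.
Qed.

Lemma Aadj_sym y : (Aadj A y)^T = Aadj A y.
Proof. by rewrite /Aadj linear_sum; apply: eq_bigr => i _;
  rewrite linearZ/= A_sym. Qed.

Definition adjoint_range : {vspace 'M[R]_p} := limg (linfun (Aadj A)).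

Lemma adjoint_rangeP X : reflect (exists y, X = Aadj A y) (X \in adjoint_range).
Proof.
apply: (iffP memv_imgP) => [[y _ ->]|[y ->]]; exists y; rewrite ?memvf ?lfunE//.
Qed.

Lemma adjoint_range_sym X : X \in adjoint_range -> X^T = X.
Proof. by move=> /adjoint_rangeP[y ->]; exact: Aadj_sym. Qed.

(** [Aop A] is injective on the range of its adjoint, as [ip y (Aop A (Aadj A
    y))] is the squared norm of [Aadj A y]; and that range consists of symmetric
    matrices. *)
Lemma dim_adjoint_range : (\dim adjoint_range <= Arank A)%N.
Proof.
have inj : (adjoint_range :&: lker (linfun (Aop A)))%VS = 0%VS.
  apply/eqP; rewrite -subv0; apply/subvP => X;
    rewrite memv_cap memv_ker lfunE/=.
  move=> /andP[/adjoint_rangeP[y ->] /eqP Ay0].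
  by rewrite memv0 -frob_eq0 -sqrf_eq0 -ip_frob ip_Aadj Ay0 /ip mulmx0 mxtrace0.
rewrite -(limg_dim_eq inj); apply: dimvS; apply: limgS.
apply/subvP => X /adjoint_range_sym Xs.
by apply/fixedSpaceP; rewrite lfunE.
Qed.

End constraint_operator.

(** * Escape from rank-deficient factors *)

Section escape.
Context {R : realType} {q m : nat} {n k : 'I_q -> nat}.
Variables (b : 'cV[R]_m) (A : forall c : 'I_q, 'I_m -> 'M[R]_(n c)).
Hypothesis A_sym : forall c i, (A c i)^T = A c i.
Variables (eps0 eps1 eps2 gamma : R) (C : forall c : 'I_q, 'M[R]_(n c)).
Hypothesis C_sym : forall c, (C c)^T = C c.
Variables (F : forall c : 'I_q, 'M[R]_(n c, k c)) (lambda : 'cV[R]_m).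
Hypothesis FA : AFAC A b C eps0 eps1 eps2 gamma F lambda.
Notation S := (slack A C lambda).

(** The cast is needed because the dimensions depend on the block. *)
Definition one_block c (M : 'M[R]_(n c, k c)) (c' : 'I_q) :
  'M[R]_(n c', k c') :=
  if c =P c' is ReflectT e then ecast i 'M[R]_(n i, k i) e M else 0.

Lemma one_block_eq c M : @one_block c M c = M.
Proof. by rewrite /one_block; case: eqP => // e; rewrite eq_axiomK. Qed.

Lemma one_block_neq c M c' : c' != c -> @one_block c M c' = 0.
Proof.
by move=> c'c; rewrite /one_block; case: eqP => // e; rewrite e eqxx in c'c.
Qed.

Lemma sum_one_block (V : zmodType) c (M : 'M[R]_(n c, k c))
    (G : forall c', 'M[R]_(n c', k c') -> V) :
  (forall c', G c' 0 = 0) -> \sum_c' G c' (one_block M c') = G c M.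
Proof.
move=> G0; rewrite (bigD1 c)//= one_block_eq big1 ?addr0// => i ic.
by rewrite one_block_neq.
Qed.

Lemma frob_outer p r (v : 'cV[R]_p) (u : 'cV[R]_r) :
  frob (v *m u^T) = frob v * frob u.
Proof.
apply/eqP; rewrite -(@eqrXn2 _ 2) ?mulr_ge0 ?frob_ge0//; apply/eqP.
rewrite exprMn !frob_sqE mulr_suml; apply: eq_bigr => i _.
rewrite big_ord1 mulr_sumr; apply: eq_bigr => j _.
by rewrite !mxE !big_ord1 mxE exprMn.
Qed.

Lemma slack_sym c : (S c)^T = S c.
Proof. by rewrite /slack linearB/= C_sym Aadj_sym. Qed.

(** The curvature condition at the direction [v *m u^T], normalised, in block
    [c]: its constraint value is [Aop] applied to [v *m (F c *m u)^T], which the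
    assumption on [u] makes small whatever [v] is. *)
Lemma escape c (u : 'cV[R]_(k c)) : u != 0 ->
  Anorm (A c) * frob (F c *m u) <= gamma * frob u ->
  loewner_ge (S c) (- eps2 *: 1%:M).
Proof.
move=> u0 Fu; have [_ _ curv] := FA.
split=> [|v]; first by rewrite linearB/= slack_sym linearZ/= trmx1.
have [->|v0] := eqVneq v 0; first by rewrite mulmx0 mxtrace0.
have {}u0 : 0 < frob u by rewrite frob_gt0.
have {}v0 : 0 < frob v by rewrite frob_gt0.
pose s := (frob v * frob u)^-1.
have s0 : 0 < s by rewrite invr_gt0 mulr_gt0.
pose M := s *: (v *m u^T).
have M1 : frob M = 1.
  by rewrite frobZ gtr0_norm// frob_outer mulVf// gt_eqF// mulr_gt0.
have := curv (one_block M).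
rewrite /oplus_norm.
rewrite (@sum_one_block R c M (fun c' X => frob X ^+ 2)); last by move=> c';
  rewrite frob0 expr0n.
rewrite M1 expr1n sqrtr1 => /(_ erefl).
rewrite (@sum_one_block _ c M (fun c' X => Aop (A c') (X *m (F c')^T)));
  last first.
  by move=> c'; rewrite mul0mx linear0.
rewrite (@sum_one_block R c M (fun c' X => \tr (X^T *m (S c' *m X))));
  last first.
  by move=> c'; rewrite !mulmx0 mxtrace0.
have MF : M *m (F c)^T = s *: (v *m (F c *m u)^T).
  by rewrite -scalemxAl trmx_mul mulmxA.
have -> : frob (Aop (A c) (M *m (F c)^T)) <= gamma.
  rewrite MF linearZ/= frobZ gtr0_norm// mulrC ler_pdivrMr ?mulr_gt0//.
  apply: le_trans (Aop_le_Anorm (A_sym c) _) _.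
  rewrite frob_outer mulrCA [gamma * _]mulrCA ler_wpM2l ?frob_ge0//.
move=> /(_ isT).
have -> : \tr (M^T *m (S c *m M)) = \tr (v^T *m S c *m v) / frob v ^+ 2.
  have MT : M^T = s *: (u *m v^T) by rewrite linearZ/= trmx_mul trmxK.
  rewrite MT /M -!scalemxAr -scalemxAl !mxtraceZ.
  have -> : (u *m v^T) *m (S c *m (v *m u^T)) = u *m (v^T *m S c *m v) *m u^T.
    by rewrite !mulmxA.
  rewrite [v^T *m S c *m v]mx11_scalar mxtrace_scalar mul_mx_scalar -scalemxAl
    mxtraceZ.
  rewrite mxtrace_mulC -/(ip u u) ip_frob /s.
  by field; rewrite !gt_eqF.
rewrite ler_pdivlMr ?exprn_gt0// => curvv.
have -> : v^T *m (S c - - eps2 *: 1%:M) *m v =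
  v^T *m S c *m v + eps2 *: (v^T *m v).
  by rewrite scaleNr opprK mulmxDr mulmxDl -scalemxAr mulmx1 -scalemxAl.
rewrite mxtraceD mxtraceZ -/(ip v v) ip_frob; lra.
Qed.

Lemma slack_mul_le c : frob (S c *m F c) <= eps1.
Proof.
have [_ SF _] := FA; apply: le_trans SF.
rewrite -[leLHS](ger0_norm (frob_ge0 _)) -sqrtr_sqr ler_wsqrtr//.
by rewrite (bigD1 c)//= lerDl sumr_ge0// => i _; rewrite sqr_ge0.
Qed.

(** By [escape], [gamma * frob u < Anorm (A c) * frob (F c *m u)] for all
    nonzero [u]; combined with the first-order condition this bounds [S c] on
    the range of [F c], and replacing [Aadj (A c) lambda] by [Y] costs another
    [delta]. *)
Lemma near_kernel c (Y : 'M[R]_(n c)) (delta : R) :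
  ~ loewner_ge (S c) (- eps2 *: 1%:M) ->
  0 < gamma -> delta = eps1 * Anorm (A c) / gamma -> 0 < delta ->
  frob (Aadj (A c) lambda - Y) <= delta ->
  exists f : 'I_(k c) -> 'I_(n c), near_singular f (2 * delta) (C c - Y).
Proof.
move=> notS g0 deltaE d0 AY; apply: (@near_kernel_near_singular _ _ _ _ (F c)).
  by rewrite mulr_ge0// ltW.
move=> u u0; have uF : 0 < frob u by rewrite frob_gt0.
have Fu : gamma * frob u < Anorm (A c) * frob (F c *m u).
  by rewrite ltNge; apply/negP => /(escape u0).
have a0 := Anorm_ge0 (A c).
have e1 : 0 < eps1.
  rewrite ltNge; apply/negP => e1; move: d0; rewrite deltaE ltNge => /negP;
    apply.
  by rewrite pmulr_lle0 ?invr_gt0// mulr_le0_ge0.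
have SFu : frob (S c *m (F c *m u)) < delta * frob (F c *m u).
  rewrite mulmxA; apply: le_lt_trans (frob_mulmx _ _) _.
  apply: (@le_lt_trans _ _ (eps1 * frob u)).
    by rewrite ler_wpM2r ?frob_ge0// slack_mul_le.
  have -> : delta * frob (F c *m u) =
    eps1 * (Anorm (A c) * frob (F c *m u) / gamma).
    by rewrite deltaE; field; rewrite gt_eqF.
  by rewrite ltr_pM2l// ltr_pdivlMr// mulrC.
have -> : C c - Y = S c + (Aadj (A c) lambda - Y) by rewrite /slack addrA subrK.
rewrite mulmxDl mulr2n mulrDl mulrDl !mul1r.
apply: le_lt_trans (ler_frobD _ _) _; apply: ltr_leD => //.
by apply: le_trans (frob_mulmx _ _) _; rewrite ler_wpM2r ?frob_ge0.
Qed.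

End escape.

(** * The failure event of one block *)

Section failure_event.
Context {R : realType} d (T : measurableType d) (P : probability T R).

Lemma probability_bigsetU_le (I : Type) (s : seq I) (Q : pred I) (E :
  I -> set T)
    (c : I -> R) : (forall i, Q i -> measurable (E i)) ->
  (forall i, Q i -> (P (E i) <= (c i)%:E)%E) ->
  measurable (\big[setU/set0]_(i <- s | Q i) E i) /\
  (P (\big[setU/set0]_(i <- s | Q i) E i) <= (\sum_(i <- s | Q i) c i)%:E)%E.
Proof.
move=> mE PE; elim: s => [|i s [IH1 IH2]]; first by rewrite !big_nil measure0.
rewrite !big_cons; case: ifPn => // Qi; split;
  first by apply: measurableU => //; exact: mE.
rewrite EFinD; apply: le_trans (measureU2 _ (mE i Qi) IH1) _.
by apply: leeD => //; exact: PE.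
Qed.

Lemma bigsetU_intro (I : eqType) (s : seq I) (Q : pred I) (E : I -> set T) i w :
  i \in s -> Q i -> E i w -> (\big[setU/set0]_(i <- s | Q i) E i) w.
Proof.
elim: s => // j s IH; rewrite inE big_cons => /orP[/eqP <-|si] Qi Ei.
  by rewrite Qi; left.
by case: ifP => _; [right|]; exact: IH.
Qed.

(** The union, over the centres [Y] of a [delta]-net of the possible values of
    [Aadj A y] and over all [f], of the events that [X - Y] is near singular.
    The net is fixed before [X] is drawn, so one event serves all [y]. *)
Lemma failure_event (m p k : nat) (A : 'I_m -> 'M[R]_p) (Cbar : 'M[R]_p)
    (sigma delta kappa : R) (X : {RV P >-> 'M[R]_p}) :
  (forall i, (A i)^T = A i) -> Cbar^T = Cbar ->
  (0 < p)%N -> (0 < k)%N -> (k <= p)%N ->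
  0 < sigma -> 0 < delta -> delta <= kappa ->
  (forall B, measurable B ->
     distribution P X B = uniform_sym_ball Cbar sigma B) ->
  exists E : set T,
    [/\ measurable E,
        (P E <= (4 * expR 1 * (3 * kappa / delta) ^+ Arank A *
          (4 * p%:R ^+ 3 * delta / sigma) ^+ tau k)%:E)%E &
        forall w, ~ E w -> forall y, frob (Aadj A y) <= kappa ->
          exists2 Y, frob (Aadj A y - Y) <= delta &
            forall f : 'I_k -> 'I_p, ~ near_singular f (2 * delta) (X w - Y)].
Proof.
move=> A_sym Cs p0 k0 kp s0 d0 dk Xunif.
have [s [s_size sU s_cover]] := covering (adjoint_range A) d0 dk.
pose e := expR 1 * (2 * delta * p%:R ^+ 2 * k%:R / sigma) ^+ tau k.
pose F Y (f : {ffun 'I_k -> 'I_p}) := X @^-1` [set D | near_singular f (2 *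
  delta) (D - Y)].
have mN Y (f : {ffun 'I_k -> 'I_p}) :
  measurable [set D | near_singular f (2 * delta) (D - Y)].
  apply: measurable_near_singular => i j.
  rewrite (_ : (fun x => _) = fun x : 'M[R]_p => x i j - Y i j).
    by apply: measurable_funB => //; exact: measurable_entry.
  by apply/funext => x; rewrite !mxE.
have mF Y f : measurable (F Y f) by apply: measurable_funPTI.
pose G Y := \big[setU/set0]_(f : {ffun 'I_k -> 'I_p}) F Y f.
have GP Y : Y \in s -> measurable (G Y) /\ (P (G Y) <= ((p ^ k)%:R * e)%:E)%E.
  move=> /sU/(adjoint_range_sym A_sym) Ys.
  have [] := @probability_bigsetU_le _ (index_enum {ffun 'I_k -> 'I_p}) xpredT
    (F Y) (fun=> e).
  - by move=> f _; exact: mF.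
  - move=> f _; rewrite -[P _]/(distribution P X _) Xunif//.
    by apply: uniform_near_singular => //; rewrite mulr_ge0// ltW.
  by move=> mG; rewrite sumr_const card_ffun !card_ord => PG; split;
    rewrite // mulr_natl.
have [||mE PE] := @probability_bigsetU_le _ s (mem s) G (fun=> (p ^ k)%:R * e).
- by move=> Y /GP[].
- by move=> Y /GP[].
exists (\big[setU/set0]_(Y <- s | Y \in s) G Y); split => //.
  apply: le_trans PE _; rewrite lee_fin -big_seq big_const_seq count_predT
    iter_addr_0 -[leLHS]mulr_natr.
  set W := (4 * _ * _ / _) ^+ _.
  have W0 : 0 <= W.
    by rewrite exprn_ge0// divr_ge0 ?mulr_ge0 ?exprn_ge0// ltW.
  have eW : (p ^ k)%:R * e <= expR 1 * W.
    by rewrite /e mulrCA ler_wpM2l ?expR_ge0// count_minors_bound// ltW.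
  have kd1 : 1 <= 3 * kappa / delta.
    rewrite ler_pdivlMr// mul1r (le_trans dk)// ler_peMl ?ler1n//.
    by rewrite (le_trans _ dk)// ltW.
  have sr : (size s)%:R <= (3 * kappa / delta) ^+ Arank A.
    by apply: le_trans s_size _; rewrite ler_weXn2l// dim_adjoint_range.
  have e0 : 0 <= (p ^ k)%:R * e.
    by rewrite mulr_ge0// mulr_ge0 ?expR_ge0// exprn_ge0// divr_ge0 ?mulr_ge0
      ?exprn_ge0// ltW.
  apply: le_trans (ler_pM e0 (ler0n _ _) eW sr) _.
  set K := (3 * kappa / delta) ^+ _.
  have K0 : 0 <= K by rewrite exprn_ge0// (le_trans ler01).
  by rewrite -!mulrA (mulrC K) ler_peMl ?ler1n// !mulr_ge0 ?expR_ge0.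
move=> w nE y yk.
have yA : Aadj A y \in adjoint_range A by apply/adjoint_rangeP; exists y.
have [Y Ys AY] := s_cover _ yA yk.
exists Y => // f fN; apply: nE; apply: (bigsetU_intro Ys) => //.
apply: (@bigsetU_intro _ _ _ _ [ffun a => f a]) => //.
  by rewrite mem_index_enum.
rewrite /F /preimage/=.
have -> // : [ffun a => f a] = f :> ('I_k -> 'I_p) by apply/funext => a;
  rewrite ffunE.
Qed.

End failure_event.

(** * The conclusion for all blocks *)

Theorem theorem2 (R : realType) (q m : nat) (n k : 'I_q -> nat)
  (q_gt0 : (0 < q)%N) (m_gt0 : (0 < m)%N)
  (n_gt0 : forall c, (0 < n c)%N) (k_gt0 : forall c, (0 < k c)%N)
  (b : 'cV[R]_m) (A : forall c : 'I_q, 'I_m -> 'M[R]_(n c))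
  (A_sym : forall c i, (A c i)^T = A c i)
  (A_rank : joint_rank A = m)
  (eps0 eps1 eps2 gamma RF Rlambda : R)
  (eps0_ge0 : 0 <= eps0) (eps1_ge0 : 0 <= eps1) (eps2_ge0 : 0 <= eps2)
  (gamma_gt0 : 0 < gamma) (RF_gt0 : 0 < RF) (Rlambda_gt0 : 0 < Rlambda)
  (Cbar : forall c : 'I_q, 'M[R]_(n c))
  (Cbar_sym : forall c, (Cbar c)^T = Cbar c)
  (sigma : 'I_q -> R) (sigma_gt0 : forall c, 0 < sigma c)
  (d : measure_display) (T : measurableType d) (P : probability T R)
  (C : forall c : 'I_q, {RV P >-> 'M[R]_(n c)})
  (C_sym : forall c w, (C c w)^T = C c w)
  (C_unif : forall c B, measurable B ->
     distribution P (C c) B = uniform_sym_ball (Cbar c) (sigma c) B)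
  (C_indep : mutually_independent C) :
  let a c := Anorm (A c) in
  let J : {set 'I_q} := [set c | (k c <= n c)%N && (0 < a c)]%SET in
  let delta c := eps1 * a c / gamma in
  let kappa c := Rlambda * a c in
  let p c := 4 * expR 1 * (3 * kappa c / delta c) ^+ Arank (A c)
             * (4 * (n c)%:R ^+ 3 * delta c / sigma c) ^+ tau (k c) in
  (forall c, c \in J ->
     [/\ (Arank (A c) < tau (k c))%N,
         0 < delta c, delta c <= kappa c &
         delta c < sigma c / (4 * (n c)%:R ^+ 3)]) ->
  (exists E : set T,
     [/\ measurable E,
         ((1 - \sum_(c in J) p c)%:E <= P E)%E &
         forall w, E w ->
         forall (F : forall c : 'I_q, 'M[R]_(n c, k c)) (lambda : 'cV[R]_m),
           AFAC A b (fun c => C c w) eps0 eps1 eps2 gamma F lambda ->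
           oplus_norm F <= RF -> frob lambda <= Rlambda ->
           let S := slack A (fun c => C c w) lambda in
           let X := gram F in
           [/\ forall c, psd (X c),
               frob (residual A b X) <= eps0,
               Num.sqrt (\sum_(c < q) frob (S c *m X c) ^+ 2) <= RF * eps1 &
               forall c, loewner_ge (S c) (- eps2 *: 1%:M)]])
  /\
  (forall D : forall c : 'I_q, 'M[R]_(n c), (forall c, (D c)^T = D c) ->
   forall (F : forall c : 'I_q, 'M[R]_(n c, k c)) (lambda : 'cV[R]_m),
     AFAC A b D eps0 eps1 eps2 gamma F lambda ->
     oplus_norm F <= RF -> frob lambda <= Rlambda ->
     forall c, (n c < k c)%N \/ a c = 0 ->
       loewner_ge (slack A D lambda c) (- eps2 *: 1%:M)).
Proof.
move=> a J delta kappa p HJ.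
have a_ge0 c : 0 <= a c by exact: Anorm_ge0.
have block_psd (D : forall c : 'I_q, 'M[R]_(n c)) (F : forall c :
  'I_q, 'M[R]_(n c, k c)) lambda c :
    (forall c, (D c)^T = D c) -> AFAC A b D eps0 eps1 eps2 gamma F lambda ->
    (n c < k c)%N \/ a c = 0 ->
    loewner_ge (slack A D lambda c) (- eps2 *: 1%:M).
  move=> D_sym FA [nk|a0].
    have [u u0 Fu] : exists2 u : 'cV[R]_(k c), u != 0 & F c *m u = 0.
      have : kermx (F c)^T != 0.
        rewrite kermx_eq0 /row_free neq_ltn; apply/orP; left.
        by rewrite (leq_ltn_trans (rank_leq_col _)).
      move=> /rowV0Pn[v /sub_kermxP vF v0]; exists v^T;
        first by rewrite trmx_eq0.
      by apply: trmx_inj; rewrite trmx_mul trmxK vF trmx0.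
    apply: (escape A_sym D_sym FA u0).
    by rewrite Fu frob0 mulr0 mulr_ge0 ?frob_ge0// ltW.
  pose u : 'cV[R]_(k c) := delta_mx (Ordinal (k_gt0 c)) 0.
  have u0 : u != 0.
    apply/eqP => /colP/(_ (Ordinal (k_gt0 c))); rewrite !mxE !eqxx => /eqP.
    by rewrite oner_eq0.
  apply: (escape A_sym D_sym FA u0).
  by rewrite -/(a c) a0 mul0r mulr_ge0 ?frob_ge0// ltW.
split; last by move=> D D_sym F lambda FA _ _ c; exact: (block_psd D F).
have fail c : exists E : set T, c \in J ->
    [/\ measurable E, (P E <= (p c)%:E)%E &
        forall w, ~ E w -> forall y, frob (Aadj (A c) y) <= kappa c ->
          exists2 Y, frob (Aadj (A c) y - Y) <= delta c &
            forall f : 'I_(k c) -> 'I_(n c),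
              ~ near_singular f (2 * delta c) (C c w - Y)].
  have [cJ|] := boolP (c \in J); last by exists set0.
  have [_ d0 dk _] := HJ c cJ; move: (cJ); rewrite finset.inE => /andP[kn _].
  have [E EP] := failure_event (A_sym c) (Cbar_sym c) (n_gt0 c) (k_gt0 c) kn
    (sigma_gt0 c) d0 dk (C_unif c).
  by exists E.
have {fail}[E EP] := choice fail.
have [||mB PB] := @probability_bigsetU_le _ _ T P _ (index_enum 'I_q) (mem J) E
  p.
- by move=> c /EP[].
- by move=> c /EP[].
set B := \big[setU/set0]_(i <- _ | _) _ in mB PB.
exists (~` B); split; first exact: measurableC.
  rewrite probability_setC// EFinB; apply: leeB => //.
move=> w nB F lambda FA FRF lR; set S := slack _ _ _; set X := gram F.
have [resF crit _] := FA.
split.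
- move=> c; split; first by rewrite /X /gram trmx_mul trmxK.
  move=> v; rewrite /X /gram (_ : _ *m _ = ((F c)^T *m v)^T *m ((F c)^T *m v)).
    by rewrite -/(ip _ _) ip_frob sqr_ge0.
  by rewrite trmx_mul trmxK !mulmxA.
- exact: resF.
- apply: (@le_trans _ _ (RF * Num.sqrt (\sum_(c < q) frob (S c *m F c) ^+ 2))).
    rewrite -[RF in leRHS](gtr0_norm RF_gt0) -sqrtr_sqr -sqrtrM ?sqr_ge0//.
    rewrite ler_wsqrtr// mulr_sumr; apply: ler_sum => c _.
    rewrite -exprMn lerXn2r ?nnegrE ?mulr_ge0 ?frob_ge0 ?(ltW RF_gt0)//.
    rewrite /X /gram mulmxA; apply: le_trans (frob_mulmx _ _) _.
    rewrite mulrC ler_wpM2r ?frob_ge0// frob_tr; apply: le_trans FRF.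
    rewrite -[leLHS](ger0_norm (frob_ge0 _)) -sqrtr_sqr ler_wsqrtr//.
    by rewrite (bigD1 c)//= lerDl sumr_ge0// => i _; rewrite sqr_ge0.
  by rewrite ler_wpM2l// ltW.
move=> c; apply: contrapT => notS.
have C_sym' c' : (C c' w)^T = C c' w by exact: C_sym.
have [cJ|] := boolP (c \in J); last first.
  rewrite finset.inE negb_and -ltnNge => /orP[nk|a0].
    by apply: notS; apply: block_psd FA _ => //; left.
  apply: notS; apply: block_psd FA _ => //; right.
  by apply/eqP; rewrite eq_le a_ge0 andbT leNgt.
have [_ _ Ew] := EP c cJ; have [_ d0 _ _] := HJ c cJ.
have nEw : ~ E c w.
  by move=> Ecw; apply: nB; apply: (bigsetU_intro (i := c)) => //;
    rewrite mem_index_enum.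
have [|Y AY nf] := Ew w nEw lambda.
  apply: le_trans (Aadj_le_Anorm (A_sym c) _) _.
  by rewrite [leRHS]mulrC ler_wpM2l// a_ge0.
have [f fN] := near_kernel A_sym C_sym' FA notS gamma_gt0 erefl d0 AY.
exact: (nf f).
Qed.
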